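(* There exist absolute constants $C\ge 1$ and $c>0$ such that the following holds. Let $d,n\ge 1$, let $X,X_1,\ldots,X_n$ be i.i.d. real random variables, and let $a=(a_1,\ldots,a_n)$ with $a_k\in\mathbf{R}^d$. Let $\alpha>0$, $\gamma\in(0,1)$, and suppose that $$\Big(\sum_{k=1}^{n}(\langle t,a_k\rangle-m_k)^2\Big)^{1/2}\geq\min\{\gamma\|t\cdot a\|,\alpha\}$$ for all $m_1,\ldots,m_n\in\mathbf{Z}$ and all $t\in\mathbf{R}^d$ with $\|t\|\le\sqrt{d}$. Then $$Q(F_a,\sqrt{d})\le C^d\Big[\Big(\frac{1}{\gamma\sqrt{M(1)}}\Big)^d\frac{1}{\sqrt{\det\mathbb{N}}}+\exp\big(-c\,\alpha^2M(1)\big)\Big].$$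
   Context: For $t\in\mathbf{R}^d$, $t\cdot a=(\langle t,a_1\rangle,\ldots,\langle t,a_n\rangle)\in\mathbf{R}^n$ and $\|t\cdot a\|$ is its Euclidean norm. $F_a$ denotes the distribution of $S_a=\sum_{k=1}^n X_k a_k\in\mathbf{R}^d$. For a distribution $F=\mathcal{L}(Y)$ of a random vector $Y$ in $\mathbf{R}^d$, the concentration function is $Q(F,\lambda)=\sup_{x\in\mathbf{R}^d}\mathbf{P}(Y\in x+\lambda B)$, $\lambda\ge0$, where $B=\{x\in\mathbf{R}^d:\|x\|\le 1\}$ and $\|\cdot\|$ is the Euclidean norm. Let $\widetilde X=X_1-X_2$ and for $\tau>0$ let $M(\tau)=\mathbf{E}\min\{\widetilde X^2/\tau^2,1\}$. The $d\times d$ matrix $\mathbb{N}=\sum_{k=1}^n a_k a_k^{T}$, i.e. $\mathbb{N}_{ij}=\sum_{k=1}^n a_{ki}a_{kj}$ where $a_k=(a_{k1},\ldots,a_{kd})$. If $\det\mathbb{N}=0$ or $M(1)=0$ the right-hand side is interpreted as $+\infty$. *)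

(* Defs.v *)
From HB Require Import structures.
From mathcomp Require Import all_boot all_order all_algebra.
From mathcomp Require Import all_classical all_reals all_analysis.
From mathcomp Require Import Rstruct Rstruct_topology.

Set Implicit Arguments. Unset Strict Implicit. Unset Printing Implicit Defensive.
Import Order.TTheory GRing.Theory Num.Theory.
Local Open Scope classical_set_scope.
Local Open Scope ring_scope.

(* Stdlib reals, packaged as a realType so that its Borel sigma-algebra is found *)
Definition RR : realType := Rdefinitions.R.

Definition vnorm (d : nat) (v : 'cV[RR]_d) : RR := Num.sqrt (\sum_i (v i 0) ^+ 2).

Definition inner (d : nat) (t u : 'cV[RR]_d) : RR := \sum_i t i 0 * u i 0.

Definition tdot_norm (d n : nat) (a : 'I_n -> 'cV[RR]_d) (t : 'cV[RR]_d) : RR :=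
  Num.sqrt (\sum_k (inner t (a k)) ^+ 2).

Definition Nmat (d n : nat) (a : 'I_n -> 'cV[RR]_d) : 'M[RR]_d :=
  \sum_k (a k *m (a k)^T).

Definition Ssum (T : Type) (d n : nat) (X : 'I_n -> T -> RR)
  (a : 'I_n -> 'cV[RR]_d) : T -> 'cV[RR]_d :=
  fun w => \sum_k (X k w *: a k).

Definition concentration (dT : measure_display) (T : measurableType dT)
  (P : probability T RR) (d : nat) (Y : T -> 'cV[RR]_d) (lam : RR) : \bar RR :=
  ereal_sup [set P [set w | vnorm (Y w - x) <= lam] | x in [set: 'cV[RR]_d]].

Definition mutually_independent (dT : measure_display) (T : measurableType dT)
  (P : probability T RR) (I : finType) (Y : I -> T -> RR) : Prop :=
  forall B : I -> set RR, (forall i, measurable (B i)) ->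
    P [set w | forall i, B i (Y i w)] = (\prod_(i : I) P (Y i @^-1` B i))%E.

(* M(tau) = E min{ Xtilde^2 / tau^2, 1 }, with Xtilde = X - X' the
   symmetrization of X (X' an independent copy), computed on P (x) P *)
Definition Mfun (dT : measure_display) (T : measurableType dT)
  (P : probability T RR) (X : T -> RR) (tau : RR) : RR :=
  fine (\int[P]_w \int[P]_w' (Num.min ((X w - X w') ^+ 2 / tau ^+ 2) 1)%:E)%E.

(* Main.v *)
Require Import Defs.
From HB Require Import structures.
From mathcomp Require Import all_boot all_order all_algebra.
From mathcomp Require Import all_classical all_reals all_analysis.
From mathcomp Require Import Rstruct Rstruct_topology.
From mathcomp Require Import exp trigo measurable_realfun complex ring lra.

(* Smoothing: a product kernel [K], nonnegative and bounded below by [c^d] on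
   the ball of radius [sqrt d], is the characteristic function of a finite
   measure on the cube [-1, 1]^d, so that the concentration function is at most
   [C^d] times the integral of [|phi|] over the cube, [phi] being the
   characteristic function of the sum. There [|phi t|] is at most
   [exp (- E h(Z t))], where [Z] is the symmetrization of [X] and
   [h(t) = sum_k (1 - cos <t, a_k>) / 2]. Jensen's inequality for the
   probability with density [q(Z) / M], [q(z) = min(z^2, 1)] and [M = E q(Z)],
   replaces it by [exp (- M h(z t) / q(z))] with [z] fixed. If [|z| <= 1], the
   arithmetic hypothesis at [z t / (2 pi)] bounds this by a Gaussian plus
   [exp (- M alpha^2)]. If [|z| > 1], the function [exp (- M h)] is a limit of
   nonnegative combinations of cosines [cos <t, u>], whose integrals
   [K(z u)] are at most [6^d K(u)]; this reduces to [z = 1]. *)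

(** The obstacle is that the hypothesis covers only [|t| <= sqrt d], while the symmetrization may
    take large values [z], and [z t] then leaves this ball. Values [|z| > 1] must therefore be
    compared with [z = 1] without any arithmetic information. That comparison needs a kernel bounded
    above by a multiple of itself after dilation, hence without zeros, while its density must have
    compact support so that [t] stays in the cube. A Gaussian fails the second requirement and the
    Fejer kernel the first. The weight [min(z^2, 1)] is chosen so that, for [|z| <= 1], the factor
    [1 / z^2] in the exponent cancels the [z^2] coming from the squared norm of [(z t).a]. The
    resulting Gaussian in [t] is the same for all [z], and in the [alpha] alternative [1 / z^2 >= 1]
    only helps. Integrating that Gaussian over the whole space instead of the cube produces
    [1 / sqrt (det N)]. *)

Set Implicit Arguments. Unset Strict Implicit. Unset Printing Implicit Defensive.
Import Order.TTheory GRing.Theory Num.Theory.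
Import numFieldNormedType.Exports.
Local Open Scope classical_set_scope.
Local Open Scope ring_scope.

(** * Integrals of bounded measurable functions *)

(** This class is stable under the operations used below and integrable for every finite measure, so
    it settles the side conditions of linearity and Fubini. *)
Definition bmeas {d} {T : measurableType d} {R : realType} (f : T -> R) : Prop :=
  measurable_fun [set: T] f /\ exists M, forall x, `|f x| <= M.

Section Bmeas.
Context d (T : measurableType d) (R : realType).
Implicit Types f g : T -> R.

Lemma bmeas_measurable f : bmeas f -> measurable_fun [set: T] f.
Proof. by case. Qed.

Lemma bmeas_cst (r : R) : bmeas (fun _ : T => r).
Proof. by split; [exact: measurable_cst | exists `|r|]. Qed.

Lemma bmeasD f g : bmeas f -> bmeas g -> bmeas (fun x => f x + g x).
Proof.
move=> [mf [A fA]] [mg [B gB]]; split; first exact: measurable_funD.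
by exists (A + B) => x; rewrite (le_trans (ler_normD _ _)) ?lerD.
Qed.

Lemma bmeasN f : bmeas f -> bmeas (fun x => - f x).
Proof.
move=> [mf [A fA]]; split; first exact: measurable_funN.
by exists A => x; rewrite normrN.
Qed.

Lemma bmeasB f g : bmeas f -> bmeas g -> bmeas (fun x => f x - g x).
Proof. by move=> bf bg; apply: bmeasD => //; exact: bmeasN. Qed.

Lemma bmeasM f g : bmeas f -> bmeas g -> bmeas (fun x => f x * g x).
Proof.
move=> [mf [A fA]] [mg [B gB]]; split; first exact: measurable_funM.
by exists (A * B) => x; rewrite normrM ler_pM.
Qed.

Lemma bmeas_sum (I : Type) (r : seq I) (P : pred I) (F : I -> T -> R) :
  (forall i, bmeas (F i)) -> bmeas (fun x => \sum_(i <- r | P i) F i x).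
Proof.
move=> bF; elim: r => [|i r IH].
  by under [X in bmeas X]eq_fun do rewrite big_nil; exact: bmeas_cst.
under [X in bmeas X]eq_fun do rewrite big_cons.
by case: (P i) => //; exact: bmeasD.
Qed.

Lemma bmeas_prod (I : Type) (r : seq I) (P : pred I) (F : I -> T -> R) :
  (forall i, bmeas (F i)) -> bmeas (fun x => \prod_(i <- r | P i) F i x).
Proof.
move=> bF; elim: r => [|i r IH].
  by under [X in bmeas X]eq_fun do rewrite big_nil; exact: bmeas_cst.
under [X in bmeas X]eq_fun do rewrite big_cons.
by case: (P i) => //; exact: bmeasM.
Qed.

Lemma bmeas_cos f : measurable_fun setT f -> bmeas (fun x => cos (f x)).
Proof.
move=> mf; split; last by exists 1 => x; exact: cos_max.
apply: (measurableT_comp _ mf); apply: continuous_measurable_fun.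
exact: continuous_cos.
Qed.

Lemma bmeas_sin f : measurable_fun setT f -> bmeas (fun x => sin (f x)).
Proof.
move=> mf; split; last by exists 1 => x; exact: sin_max.
apply: (measurableT_comp _ mf); apply: continuous_measurable_fun.
exact: continuous_sin.
Qed.

Lemma bmeas_exp f : bmeas f -> bmeas (fun x => expR (f x)).
Proof.
move=> [mf [A fA]]; split; first exact: (measurableT_comp (@measurable_expR R) mf).
exists (expR A) => x; rewrite ger0_norm ?expR_ge0// ler_expR.
exact: le_trans (ler_norm _) (fA x).
Qed.

Lemma bmeas_expN f : measurable_fun setT f -> (forall x, 0 <= f x) ->
  bmeas (fun x => expR (- f x)).
Proof.
move=> mf f0; split.
  by apply: (measurableT_comp (@measurable_expR R)); exact: measurable_funN.
by exists 1 => x; rewrite ger0_norm ?expR_ge0// -expR0 ler_expR oppr_le0.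
Qed.

Lemma bmeas_comp d' (T' : measurableType d') (f : T -> R) (g : T' -> T) :
  bmeas f -> measurable_fun setT g -> bmeas (fun x => f (g x)).
Proof.
move=> [mf [A fA]] mg; split; first exact: measurableT_comp mf mg.
by exists A => x.
Qed.

Lemma measurable_fun_bigsum (I : Type) (r : seq I) (P : pred I) (F : I -> T -> R) :
  (forall i, measurable_fun setT (F i)) ->
  measurable_fun setT (fun x => \sum_(i <- r | P i) F i x).
Proof.
move=> bF; elim: r => [|i r IH].
  by under eq_fun do rewrite big_nil; exact: measurable_cst.
under eq_fun do rewrite big_cons.
by case: (P i) => //; exact: measurable_funD.
Qed.

End Bmeas.

Section Expectation.
Context d (T : measurableType d) (R : realType) (mu : subprobability T R).
Implicit Types f g : T -> R.

Lemma subprob_ltey : (mu setT < +oo)%E.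
Proof. by rewrite (le_lt_trans (@sprobability_setT _ _ _ mu))// ltry. Qed.

Lemma bmeas_integrable f : bmeas f -> mu.-integrable setT (EFin \o f).
Proof.
move=> [mf [A fA]]; apply: measurable_bounded_integrable => //.
  exact: subprob_ltey.
exists A; split; first exact: num_real.
by move=> y Ay x _ /=; apply: le_trans (fA x) (ltW Ay).
Qed.

Lemma ExD f g : bmeas f -> bmeas g ->
  \int[mu]_x (f x + g x) = \int[mu]_x f x + \int[mu]_x g x.
Proof. by move=> bf bg; rewrite RintegralD//; exact: bmeas_integrable. Qed.

Lemma ExB f g : bmeas f -> bmeas g ->
  \int[mu]_x (f x - g x) = \int[mu]_x f x - \int[mu]_x g x.
Proof. by move=> bf bg; rewrite RintegralB//; exact: bmeas_integrable. Qed.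

Lemma ExZ r f : bmeas f -> \int[mu]_x (r * f x) = r * \int[mu]_x f x.
Proof. by move=> bf; rewrite RintegralZl//; exact: bmeas_integrable. Qed.

Lemma ExZr r f : bmeas f -> \int[mu]_x (f x * r) = (\int[mu]_x f x) * r.
Proof. by move=> bf; rewrite RintegralZr//; exact: bmeas_integrable. Qed.

Lemma Ex_le f g : bmeas f -> bmeas g -> (forall x, f x <= g x) ->
  \int[mu]_x f x <= \int[mu]_x g x.
Proof.
by move=> bf bg fg; apply: le_Rintegral => //; exact: bmeas_integrable.
Qed.

Lemma Ex_ge0 f : (forall x, 0 <= f x) -> 0 <= \int[mu]_x f x.
Proof. by move=> f0; exact: Rintegral_ge0. Qed.

Lemma Ex_sum (I : Type) (r : seq I) (P : pred I) (F : I -> T -> R) :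
  (forall i, bmeas (F i)) ->
  \int[mu]_x (\sum_(i <- r | P i) F i x) = \sum_(i <- r | P i) \int[mu]_x F i x.
Proof.
move=> bF; elim: r => [|i r IH].
  rewrite big_nil; under eq_Rintegral do rewrite big_nil.
  by rewrite Rintegral_cst// mul0r.
rewrite big_cons; under eq_Rintegral do rewrite big_cons.
case: (P i) => //; rewrite ExD// ?IH//; exact: bmeas_sum.
Qed.

Lemma Ex_norm_le f A : bmeas f -> 0 <= A -> (forall x, `|f x| <= A) ->
  `|\int[mu]_x f x| <= A.
Proof.
move=> bf A0 fA; apply: (le_trans (le_normr_Rintegral _ _)) => //.
  exact: bmeas_integrable.
apply: (@le_trans _ _ (\int[mu]_x A)).
  apply: Ex_le => //; last exact: bmeas_cst.
  by case: bf => mf [B fB]; split;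
    [exact: measurableT_comp | exists B => x; rewrite normr_id].
rewrite Rintegral_cst// -[leRHS]mulr1 ler_wpM2l//.
rewrite -lee_fin fineK; first exact: sprobability_setT.
by rewrite ge0_fin_numE//; exact: subprob_ltey.
Qed.

Lemma EFin_Ex f : bmeas f -> (\int[mu]_x f x)%:E = (\int[mu]_x (f x)%:E)%E.
Proof.
by move=> bf; rewrite /Rintegral fineK//; apply: integrable_fin_num => //; exact: bmeas_integrable.
Qed.

End Expectation.

Lemma Ex_prob_cst d (T : measurableType d) (R : realType) (P : probability T R) (r : R) :
  \int[P]_x r = r.
Proof.
rewrite Rintegral_cst// [X in fine X](_ : _ = 1%E) ?mulr1//.
exact: probability_setT.
Qed.

Section FubiniBounded.
Context d1 d2 (T1 : measurableType d1) (T2 : measurableType d2) (R : realType).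
Variables (m1 : subprobability T1 R) (m2 : subprobability T2 R).

Lemma bmeas_fst (f : T1 * T2 -> R) y : bmeas f -> bmeas (fun x => f (x, y)).
Proof.
by move=> bf; apply: (bmeas_comp bf); exact: measurable_pair2.
Qed.

Lemma bmeas_snd (f : T1 * T2 -> R) x : bmeas f -> bmeas (fun y => f (x, y)).
Proof.
by move=> bf; apply: (bmeas_comp bf); exact: measurable_pair1.
Qed.

Variable f : T1 * T2 -> R.
Hypothesis bf : bmeas f.

Let intf : (m1 \x m2)%E.-integrable setT (EFin \o f).
Proof. exact: (@bmeas_integrable _ _ _ (product_subprobability (m1, m2))). Qed.

Lemma bmeas_Ex2 : bmeas (fun x => \int[m2]_y f (x, y)).
Proof.
split.
  apply: measurableT_comp; first exact: fine_measurable.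
  exact: (measurable_fubini_F intf).
have [mf [A fA]] := bf; exists `|A| => x; apply: Ex_norm_le => //.
  exact: bmeas_snd.
by move=> y; rewrite (le_trans (fA _))// ler_norm.
Qed.

Lemma bmeas_Ex1 : bmeas (fun y => \int[m1]_x f (x, y)).
Proof.
split.
  apply: measurableT_comp; first exact: fine_measurable.
  exact: (measurable_fubini_G intf).
have [mf [A fA]] := bf; exists `|A| => y; apply: Ex_norm_le => //.
  exact: bmeas_fst.
by move=> x; rewrite (le_trans (fA _))// ler_norm.
Qed.

Lemma Ex_prod2 : \int[m1]_x \int[m2]_y f (x, y) =
  \int[product_subprobability (m1, m2)]_z f z.
Proof.
rewrite {3}/Rintegral -(integral12_prod_meas1 intf) {1}/Rintegral.
congr fine; apply: eq_integral => x _.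
by rewrite EFin_Ex//; exact: bmeas_snd.
Qed.

Lemma Ex_swap : \int[m1]_x \int[m2]_y f (x, y) = \int[m2]_y \int[m1]_x f (x, y).
Proof.
rewrite {1}/Rintegral {3}/Rintegral; congr fine.
transitivity (\int[m1]_x (fubini_F m2 (EFin \o f)) x)%E.
  by apply: eq_integral => x _; rewrite EFin_Ex//; exact: bmeas_snd.
transitivity (\int[m2]_y (fubini_G m1 (EFin \o f)) y)%E.
  exact: Fubini intf.
by apply: eq_integral => x _; rewrite EFin_Ex//; exact: bmeas_fst.
Qed.

End FubiniBounded.

(** * Trigonometric inequalities and the one-dimensional kernel *)

Section Trig.
Context {R : realType}.
Implicit Types x y : R.

Lemma sin_leid x : 0 <= x -> sin x <= x.
Proof.
rewrite le_eqVlt => /predU1P[<-|x0]; first by rewrite sin0.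
have [c _] := @MVT R sin cos 0 x x0 (fun z _ => is_derive_sin z)
  (continuous_subspaceT (@continuous_sin R)).
rewrite sin0 !subr0 => ->.
by rewrite ler_piMl ?cos_le1// ltW.
Qed.

Lemma sin_half x : sin x = 2 * (cos (x / 2) * sin (x / 2)).
Proof.
have {1}-> : x = (x / 2) *+ 2 by rewrite -mulr_natr divfK ?pnatr_eq0.
by rewrite sin_mulr2n mulr_natl.
Qed.

Lemma cos_half x : cos x = 2 * cos (x / 2) ^+ 2 - 1.
Proof.
have {1}-> : x = (x / 2) *+ 2 by rewrite -mulr_natr divfK ?pnatr_eq0.
by rewrite cos_mulr2n mulr_natl.
Qed.

(** By the mean value theorem [sin (x / 2) >= cos (x / 2) * x / 2]. Doubling the angle gives
    [sin x >= cos (x / 2) ^ 2 * x], and the squared cosine is [(1 + cos x) / 2 >= 1 / 2]. *)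
Lemma sin_ge_half x : 0 <= x <= pi / 2 -> x / 2 <= sin x.
Proof.
case/andP; rewrite le_eqVlt => /predU1P[<-|x0 xp]; first by rewrite sin0 mul0r.
have [c] := @MVT R sin cos 0 (x / 2) (divr_gt0 x0 (ltr0n _ 2))
  (fun z _ => is_derive_sin z) (continuous_subspaceT (@continuous_sin R)).
rewrite in_itv/= sin0 !subr0 => /andP[c0 cx] sE.
have pi0 := @pi_gt0 R.
have cosE : cos (x / 2) ^+ 2 >= 1 / 2.
  have := cos_half x; have : 0 <= cos x by apply: cos_ge0_pihalf; lra.
  lra.
have cos0 : 0 <= cos (x / 2) by apply: cos_ge0_pihalf; lra.
have cc : cos (x / 2) <= cos c.
  by rewrite leNgt ltr_cos ?in_itv/=; first rewrite -leNgt; lra.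
rewrite sin_half sE.
have : cos (x / 2) ^+ 2 * x <= cos (x / 2) * cos c * x.
  by rewrite expr2 ler_wpM2r ?ler_wpM2l// ltW.
have : 1 / 2 * x <= cos (x / 2) ^+ 2 * x by rewrite ler_wpM2r// ltW.
lra.
Qed.

(** [1 - cos x = 2 sin^2 (x / 2)], and [sin (x / 2) >= x / 4] for [0 <= x <= pi]. *)
Lemma cos_le_sqr x : `|x| <= pi -> x ^+ 2 / 8 <= 1 - cos x.
Proof.
move=> xp; rewrite -cos_norm -(@real_normK R x) ?num_real//.
move: xp; have : 0 <= `|x| by []; move: `|x| => {x} x x0 xp.
have -> : cos x = 1 - 2 * sin (x / 2) ^+ 2.
  by rewrite cos_half cos2sin2; ring.
have : (x / 2 / 2) ^+ 2 <= sin (x / 2) ^+ 2.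
  have h : x / 2 / 2 <= sin (x / 2) by apply: sin_ge_half; lra.
  by rewrite lerXn2r// nnegrE; lra.
by lra.
Qed.

(** Since [sin (x / 2) <= x / 2], doubling the angle gives [x - sin x >= x (1 - cos (x / 2))], and
    the bracket is at least [x^2 / 32]. *)
Lemma id_sub_sin_ge x : 0 <= x <= 2 -> x ^+ 3 / 32 <= x - sin x.
Proof.
move=> /andP[x0 x2].
have pi2 := @pi_ge2 R.
rewrite sin_half.
have s1 : sin (x / 2) <= x / 2 by apply: sin_leid; lra.
have c1 : (x / 2) ^+ 2 / 8 <= 1 - cos (x / 2).
  by apply: cos_le_sqr; rewrite ger0_norm; lra.
have c0 : 0 <= cos (x / 2) by apply: cos_ge0_pihalf; lra.
have : cos (x / 2) * sin (x / 2) <= cos (x / 2) * (x / 2) by rewrite ler_wpM2l.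
have : (x / 2) ^+ 2 / 8 * x <= (1 - cos (x / 2)) * x by rewrite ler_wpM2r.
rewrite !exprS !expr0; lra.
Qed.

(* The Fourier transform of the density [3 / 2 (1 - |x|)_+^2], see [Ex_tri2_cos];
   unlike the Fejer kernel it has no zeros, and it decays like [1 / y^2]. *)
Definition kker y : R := if y == 0 then 1 else 6 * (y - sin y) / y ^+ 3.

Lemma kkerN y : kker (- y) = kker y.
Proof.
rewrite /kker oppr_eq0; case: eqVneq => // y0.
by rewrite sinN; field.
Qed.

Lemma kker_norm y : kker `|y| = kker y.
Proof. by case: (ger0P y) => // _; rewrite kkerN. Qed.

Lemma kker_ge_in y : `|y| <= 2 -> 3 / 16 <= kker y.
Proof.
rewrite -kker_norm; have : 0 <= `|y| by []; move: `|y| => {y} y y0 y2.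
rewrite /kker; case: eqVneq => [_|yN0]; first lra.
have yp : 0 < y by lra.
rewrite ler_pdivlMr ?exprn_gt0//.
have := @id_sub_sin_ge y; rewrite y0 y2 => /(_ isT); lra.
Qed.

Lemma kker_ge_out y : 2 <= `|y| -> 3 / y ^+ 2 <= kker y.
Proof.
rewrite -kker_norm -(@real_normK R y) ?num_real//.
have : 0 <= `|y| by []; move: `|y| => {y} y y0 y2.
rewrite /kker; case: eqVneq => [y0'|yN0]; first lra.
have yp : 0 < y by lra.
rewrite ler_pdivlMr ?exprn_gt0//.
have -> : 3 / y ^+ 2 * y ^+ 3 = 3 * y by field.
have := sin_le1 y; lra.
Qed.

Lemma kker_le y : y != 0 -> kker y <= 12 / y ^+ 2.
Proof.
rewrite -kker_norm -(@real_normK R y) ?num_real// => yN0.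
have : 0 < `|y| by rewrite normr_gt0.
move: `|y| => {yN0}y yp.
rewrite /kker gt_eqF// ler_pdivrMr ?exprn_gt0//.
have -> : 12 / y ^+ 2 * y ^+ 3 = 12 * y by field; rewrite gt_eqF.
suff : - sin y <= y by lra.
have [y1|y1] := leP y 1; last by have := sin_geN1 y; lra.
have pi2 := @pi_ge2 R.
have := @sin_ge_half y; rewrite ltW//= => h; have : y / 2 <= sin y by apply: h; lra.
by lra.
Qed.

Lemma kker_ge0 y : 0 <= kker y.
Proof.
case: (leP `|y| 2) => [/kker_ge_in|/ltW/kker_ge_out]; first by lra.
by apply: le_trans; rewrite divr_ge0 ?sqr_ge0.
Qed.

(** A Gaussian minorant makes a product of kernels depend on the Euclidean norm only, which is what
    a lower bound on a ball requires. *)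
Lemma kker_ge_gauss y : 3 / 16 * expR (- y ^+ 2) <= kker y.
Proof.
have y2 : 0 <= y ^+ 2 by exact: sqr_ge0.
case: (leP `|y| 2) => [/kker_ge_in|h].
  apply: le_trans; rewrite ger_pMr ?divr_gt0// -expR0 ler_expR; lra.
apply: le_trans (kker_ge_out (ltW h)).
have yp : 0 < y ^+ 2 by rewrite exprn_even_gt0//= -normr_gt0; lra.
rewrite ler_pdivlMr//.
have := expR_ge1Dx (y ^+ 2); have := expR_gt0 (- y ^+ 2).
have := expRxMexpNx_1 (y ^+ 2).
move: (expR (y ^+ 2)) (expR (- y ^+ 2)) => a b ab b0 a1.
have b0' : 0 <= b by rewrite ltW.
have : (1 + y ^+ 2) * b <= a * b by exact: ler_wpM2r.
rewrite ab; lra.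
Qed.

End Trig.

(** * The density of the kernel on [[-1, 1]] *)

Section UniformLaw.
Context {R : realType}.

Lemma ltN11_subproof : (-1 : R) < 1. Proof. lra. Qed.

Definition unif11 : probability (measurableTypeR R) R := uniform_prob ltN11_subproof.

Lemma integral_itv_antiderivative (f fp F : R -> R) (a b : R) : a < b ->
  (forall x : R, is_derive x 1 F (fp x)) -> continuous fp ->
  {in `[a, b], f =1 fp} ->
  (\int[lebesgue_measure]_(x in `[a, b]) (f x)%:E)%E = (F b - F a)%:E.
Proof.
move=> ab dF cf ffp.
have cF : continuous F.
  move=> x; apply: differentiable_continuous; apply/derivable1_diffP.
  by case: (dF x).
transitivity (\int[lebesgue_measure]_(x in `[a, b]) (fp x)%:E)%E.
  by apply: eq_integral => x; rewrite inE/= => xab; rewrite ffp.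
rewrite (@continuous_FTC2 _ _ F)//.
- exact: continuous_subspaceT.
- split; first by move=> x _; case: (dF x).
  + by apply: cvg_at_right_filter; exact: cF.
  + by apply: cvg_at_left_filter; exact: cF.
- by move=> x _; rewrite derive1E; case: (dF x).
Qed.

(** The density has a corner at [0], so each half of the interval gets its own formula, continuous
    on the whole line, and its own antiderivative. *)
Lemma Ex_unif11 (f fp fm F G : R -> R) :
  @bmeas _ (measurableTypeR R) R f -> (forall x, 0 <= f x) ->
  (forall x : R, is_derive x 1 F (fp x)) -> continuous fp ->
  {in `[0, 1], f =1 fp} ->
  (forall x : R, is_derive x 1 G (fm x)) -> continuous fm ->
  {in `[-1, 0], f =1 fm} ->
  \int[unif11]_x f x = (F 1 - F 0 + (G 0 - G (-1))) / 2.
Proof.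
move=> [mf _] f0 dF cfp ffp dG cfm ffm.
rewrite /Rintegral integral_uniform//; last by apply/(@measurable_EFinP _ (measurableTypeR R) R).
have -> : `[(-1 : R), 1]%classic = `[-1, 0]%classic `|` `]0, 1]%classic.
  by apply: itv_bndbnd_setU; rewrite bnd_simp; lra.
rewrite ge0_integral_setU//=; last 3 first.
- apply/(@measurable_EFinP _ (measurableTypeR R) R).
  exact: measurable_funS mf.
- by move=> x _; rewrite lee_fin.
- apply/disj_setPS => x [] /=; rewrite !in_itv/=; lra.
rewrite integral_itv_obnd_cbnd; last first.
  apply/(@measurable_EFinP _ (measurableTypeR R) R).
  exact: measurable_funS mf.
rewrite (integral_itv_antiderivative _ dG cfm ffm); last by lra.
rewrite (integral_itv_antiderivative _ dF cfp ffp); last by lra.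
rewrite -EFinD -EFinM/= mulrC addrC; congr (_ / _); lra.
Qed.

(* Twice the density of [kker], as it is integrated against the uniform law. *)
Definition tri2 (x : R) : R := 3 * (Num.max 0 (1 - `|x|)) ^+ 2.

Lemma tri2_ge0 x : 0 <= tri2 x.
Proof. by rewrite mulr_ge0// sqr_ge0. Qed.

Lemma tri2_out x : 1 < `|x| -> tri2 x = 0.
Proof. by move=> x1; rewrite /tri2 max_l ?expr0n/= ?mulr0//; lra. Qed.

Lemma tri2_le3 x : tri2 x <= 3.
Proof.
have m0 : 0 <= Num.max 0 (1 - `|x|) by rewrite le_max lexx.
have m1 : Num.max 0 (1 - `|x|) <= 1 by rewrite ge_max ler01 gerBl normr_ge0.
by have := exprn_ile1 2 m0 m1; rewrite /tri2; lra.
Qed.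

Lemma bmeas_tri2 : @bmeas _ (measurableTypeR R) R tri2.
Proof.
split; last by exists 3 => x; rewrite ger0_norm ?tri2_ge0 ?tri2_le3.
apply: measurable_funM => //; apply: measurable_funX.
apply: measurable_maxr => //; apply: measurable_funB => //.
Qed.

Lemma tri2_pos : {in `[0, 1], tri2 =1 fun x => 3 * (1 - x) ^+ 2}.
Proof.
by move=> x; rewrite in_itv/= => x01; rewrite /tri2 ger0_norm ?max_r//; lra.
Qed.

Lemma tri2_neg : {in `[-1, 0], tri2 =1 fun x => 3 * (1 + x) ^+ 2}.
Proof.
by move=> x; rewrite in_itv/= => x01; rewrite /tri2 ler0_norm ?max_r ?opprK//; lra.
Qed.

Lemma Ex_tri2 : \int[unif11]_x tri2 x = 1.
Proof.
rewrite (Ex_unif11 (F := fun x => - (1 - x) ^+ 3) (G := fun x => (1 + x) ^+ 3)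
  bmeas_tri2 tri2_ge0 _ _ tri2_pos _ _ tri2_neg).
- by rewrite !exprS expr0; lra.
- move=> x; apply: is_derive_eq; rewrite /GRing.scale/=; ring.
- by move=> x; apply: differentiable_continuous; apply/derivable1_diffP; apply: ex_derive.
- move=> x; apply: is_derive_eq; rewrite /GRing.scale/=; ring.
- by move=> x; apply: differentiable_continuous; apply/derivable1_diffP; apply: ex_derive.
Qed.

Lemma measurable_affine (y c : R) :
  measurable_fun [set: measurableTypeR R] (fun x : R => x * y + c).
Proof.
by apply: measurable_funD => //; apply: measurable_funM.
Qed.

(** The phase [c] makes the formula usable coordinate by coordinate: the contribution of the other
    coordinates to the argument of the cosine enters through it. *)
Lemma Ex_tri2_cos (y c : R) : \int[unif11]_x (tri2 x * cos (x * y + c)) = kker y * cos c.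
Proof.
have bc := bmeas_cos (measurable_affine y c).
rewrite /kker; case: eqVneq => [->|y0].
  under eq_Rintegral do rewrite mulr0 add0r.
  by rewrite ExZr ?Ex_tri2//; exact: bmeas_tri2.
have bM := bmeasM bmeas_tri2 bc.
(* [Ex_unif11] wants a nonnegative integrand, so [tri2], of integral [1], is added and [1]
   subtracted. *)
have <- : \int[unif11]_x (tri2 x + tri2 x * cos (x * y + c)) - 1 =
    \int[unif11]_x (tri2 x * cos (x * y + c)).
  by rewrite ExD ?Ex_tri2//; [ring | exact: bmeas_tri2].
(* [F] and [G] come from integrating by parts twice against the quadratic factor. *)
pose F (x : R) : R := - (1 - x) ^+ 3 + 3 * ((1 - x) ^+ 2 * sin (x * y + c) / y
   - 2 * (1 - x) * cos (x * y + c) / y ^+ 2 - 2 * sin (x * y + c) / y ^+ 3).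
pose G (x : R) : R := (1 + x) ^+ 3 + 3 * ((1 + x) ^+ 2 * sin (x * y + c) / y
   + 2 * (1 + x) * cos (x * y + c) / y ^+ 2 - 2 * sin (x * y + c) / y ^+ 3).
pose fp (x : R) : R := 3 * (1 - x) ^+ 2 * (1 + cos (x * y + c)).
pose fm (x : R) : R := 3 * (1 + x) ^+ 2 * (1 + cos (x * y + c)).
have dl (x : R) : is_derive x 1 (fun x : R => x * y + c) y.
  by apply: is_derive_eq; rewrite /GRing.scale/=; ring.
have ds (x : R) : is_derive x 1 (fun x : R => sin (x * y + c)) (cos (x * y + c) * y).
  exact: (is_derive1_comp (is_derive_sin _) (dl x)).
have dc (x : R) : is_derive x 1 (fun x : R => cos (x * y + c)) (- sin (x * y + c) * y).
  exact: (is_derive1_comp (is_derive_cos _) (dl x)).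
have cc : continuous (fun x : R => cos (x * y + c)).
  by move=> x; apply: differentiable_continuous; apply/derivable1_diffP; apply: ex_derive.
have dF (x : R) : is_derive x 1 F (fp x).
  by rewrite /F /fp; apply: is_derive_eq; rewrite /GRing.scale/=; field.
have dG (x : R) : is_derive x 1 G (fm x).
  by rewrite /G /fm; apply: is_derive_eq; rewrite /GRing.scale/=; field.
have cp : continuous fp.
  by move=> x; apply: differentiable_continuous; apply/derivable1_diffP; apply: ex_derive.
have cm : continuous fm.
  by move=> x; apply: differentiable_continuous; apply/derivable1_diffP; apply: ex_derive.
have g0 (x : R) : 0 <= tri2 x + tri2 x * cos (x * y + c).
  rewrite -{1}[tri2 x]mulr1 -mulrDr mulr_ge0 ?tri2_ge0//.
rewrite (Ex_unif11 _ g0 dF cp _ dG cm _).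
- rewrite /F /G !mulN1r !mul1r !mul0r !add0r !subrr !addr0 !subr0.
  rewrite sinD [sin (- y + c)]sinD cosN sinN; field; exact: y0.
- by apply: bmeasD => //; exact: bmeas_tri2.
- by move=> x x01; rewrite /fp (tri2_pos x01)/=; ring.
- by move=> x x01; rewrite /fm (tri2_neg x01)/=; ring.
Qed.

Lemma kker_le1 (y : R) : kker y <= 1.
Proof.
have := Ex_tri2_cos y 0; rewrite cos0 mulr1 => <-; rewrite -Ex_tri2.
have bc := bmeas_cos (measurable_affine y 0).
apply: Ex_le; [exact: bmeasM bmeas_tri2 bc | exact: bmeas_tri2|].
by move=> x; rewrite ler_piMr ?tri2_ge0 ?cos_le1.
Qed.

(** For [|y| <= 2] the left side is at most [1] and [6 * 3 / 16 > 1]. For larger [|y|] the upper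
    bound [12 / (z y)^2 <= 12 / y^2] is four times the lower bound [3 / y^2]. *)
Lemma kker_scale (z y : R) : 1 <= `|z| -> kker (z * y) <= 6 * kker y.
Proof.
move=> z1; case: (leP `|y| 2) => [/kker_ge_in h|/ltW h].
  by have := kker_le1 (z * y); lra.
have yp : 0 < y ^+ 2 by rewrite exprn_even_gt0//= -normr_gt0; lra.
have z2 : 1 <= z ^+ 2 by rewrite -real_normK ?num_real// exprn_ege1.
have zy : kker (z * y) <= 12 / (z * y) ^+ 2.
  apply: kker_le; rewrite mulf_neq0// -normr_eq0 gt_eqF//; lra.
have := kker_ge_out h.
suff : 12 / (z * y) ^+ 2 <= 12 / y ^+ 2.
  by have : 12 / y ^+ 2 = 4 * (3 / y ^+ 2) by [field; rewrite -sqrf_eq0 gt_eqF]; have := kker_ge0 y; lra.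
rewrite ler_pM2l// lef_pV2 ?posrE//; last by rewrite exprMn mulr_gt0//; lra.
by rewrite exprMn ler_peMl// ltW.
Qed.

End UniformLaw.

Section Gauss.
Context {R : realType}.

(** The factor [3 / 2] is the maximum of [tri2] times the uniform density; the rest is the Gaussian
    integral over the line. Uniformity in the shift [b] is essential: completing the square produces
    a shift depending on the other coordinates. *)
Lemma Ex_tri2_gauss (a b : R) : 0 < a ->
  \int[unif11]_x (tri2 x * expR (- (a * (x + b) ^+ 2))) <= 3 / 2 * Num.sqrt pi / Num.sqrt a.
Proof.
move=> a0.
(* The standard deviation for which [1 / (2 s^2) = a]. *)
pose s := Num.sqrt (2 * a)^-1.
have s2 : s ^+ 2 *+ 2 = a^-1.
  rewrite sqr_sqrtr ?invr_ge0; last by lra.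
  by rewrite -mulr_natr; field; rewrite gt_eqF.
have s0 : s != 0 by rewrite gt_eqF// sqrtr_gt0 invr_gt0; lra.
pose K : R := 3 * (Num.sqrt pi / Num.sqrt a).
have pk : normal_peak s = (Num.sqrt pi / Num.sqrt a)^-1.
  rewrite /normal_peak -mulrnAl s2 sqrtrM ?invr_ge0 ?ltW// sqrtrV ?ltW//.
  by rewrite mulrC.
have pos : 0 < Num.sqrt pi / Num.sqrt a by rewrite divr_gt0 ?sqrtr_gt0 ?pi_gt0.
have tle x : tri2 x * expR (- (a * (x + b) ^+ 2)) <= K * normal_pdf (- b) s x.
  rewrite normal_pdfE// pk /normal_fun s2 invrK opprK.
  rewrite [_ * a]mulrC mulrN /K.
  rewrite [leRHS]mulrA mulfK ?gt_eqF//.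
  by rewrite ler_wpM2r ?expR_ge0 ?tri2_le3.
have mK : measurable_fun [set: measurableTypeR R] (fun x : R => K * normal_pdf (- b) s x).
  by apply: measurable_funM => //; exact: measurable_normal_pdf.
have mf : measurable_fun [set: measurableTypeR R]
    (fun x : R => tri2 x * expR (- (a * (x + b) ^+ 2))).
  have [mt _] := @bmeas_tri2 R; apply: measurable_funM => //.
  apply: (measurableT_comp (@measurable_expR R)); apply: measurable_funN.
  by apply: measurable_funM => //; apply: measurable_funX; apply: measurable_funD.
rewrite /Rintegral integral_uniform//; last 2 first.
- by apply/(@measurable_EFinP _ (measurableTypeR R) R).
- by move=> x; rewrite lee_fin mulr_ge0 ?tri2_ge0 ?expR_ge0.
have le1 : (\int[lebesgue_measure]_(x in `[(-1)%R, 1%R]) (tri2 x * expR (- (a * (x + b) ^+ 2)))%:E <= K%:E)%E.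
  apply: (@le_trans _ _ (\int[lebesgue_measure]_x (K * normal_pdf (- b) s x)%:E)%E); last first.
    under eq_integral do rewrite EFinM.
    rewrite integralZl//; last exact: integrable_normal_pdf.
    by rewrite integral_normal_pdf mule1.
  apply: (@le_trans _ _ (\int[lebesgue_measure]_(x in `[(-1)%R, 1%R]) (K * normal_pdf (- b) s x)%:E)%E).
    apply: ge0_le_integral => //.
    - by move=> x _; rewrite lee_fin mulr_ge0 ?tri2_ge0 ?expR_ge0.
    - apply/(@measurable_EFinP _ (measurableTypeR R) R).
      exact: measurable_funS mf.
    - apply/(@measurable_EFinP _ (measurableTypeR R) R).
      exact: measurable_funS mK.
    - by move=> x _; rewrite lee_fin tle.
  apply: ge0_subset_integral => //.
  - by apply/(@measurable_EFinP _ (measurableTypeR R) R).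
  - by move=> x _; rewrite lee_fin mulr_ge0 ?normal_pdf_ge0// mulr_ge0// ltW.
set I := (\int[_]_(x in _) _)%E in le1 *.
have I0 : (0 <= I)%E.
  by apply: integral_ge0 => x _; rewrite lee_fin mulr_ge0 ?tri2_ge0 ?expR_ge0.
case: I le1 I0 => [r| |]//=; rewrite !lee_fin /K => rK _.
have -> : (1 - -1)^-1 = 2^-1 :> R by congr (_^-1); ring.
by rewrite -mulrA; lra.
Qed.

End Gauss.

(** * A random vector in the cube *)

Section QuadraticForm.
Context {R : realType}.

Definition qform d (N : 'M[R]_d) (v : 'cV[R]_d) : R := (v^T *m N *m v) 0 0.

Lemma qformE d (N : 'M[R]_d) v : qform N v = \sum_j \sum_i v i 0 * N i j * v j 0.
Proof.
rewrite /qform !mxE; apply: eq_bigr => j _; rewrite !mxE mulr_suml.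
by apply: eq_bigr => i _; rewrite mxE.
Qed.

Definition posdef d (N : 'M[R]_d) := N^T = N /\ forall v : 'cV[R]_d, v != 0 -> 0 < qform N v.

Lemma posdef_qform_ge0 d (N : 'M[R]_d) v : posdef N -> 0 <= qform N v.
Proof.
move=> [_ pN]; have [->|/pN/ltW//] := eqVneq v 0.
by rewrite /qform mulmx0 mxE.
Qed.

Definition schur d (N : 'M[R]_(1 + d)) : 'M[R]_d :=
  drsubmx N - (N 0 0)^-1 *: (dlsubmx N *m (dlsubmx N)^T).

Definition pivot_shift d (N : 'M[R]_(1 + d)) (u : 'cV[R]_d) : R :=
  (N 0 0)^-1 * ((dlsubmx N)^T *m u) 0 0.

Lemma sym_block d (N : 'M[R]_(1 + d)) : N^T = N ->
  N = block_mx (N 0 0)%:M (dlsubmx N)^T (dlsubmx N) (drsubmx N).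
Proof.
move=> sN; rewrite -{1}(submxK N); congr block_mx.
  apply/matrixP => i j; rewrite !mxE !ord1 eqxx mulr1n.
  by congr (N _ _); apply/val_inj.
by rewrite trmx_dlsub sN.
Qed.

(** Completing the square in the first coordinate. Together with [det_schur] it lets a Gaussian
    integral be bounded one coordinate at a time, without diagonalizing [N]. *)
Lemma qform_schur d (N : 'M[R]_(1 + d)) x (u : 'cV[R]_d) : N^T = N -> N 0 0 != 0 ->
  qform N (col_mx x%:M u) = N 0 0 * (x + pivot_shift N u) ^+ 2 + qform (schur N) u.
Proof.
move=> sN a0; rewrite /qform /schur /pivot_shift.
rewrite {1}(sym_block sN); move: (N 0 0) (dlsubmx N) (drsubmx N) a0 => a b D a0.
rewrite tr_col_mx mul_row_block mul_row_col tr_scalar_mx.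
set s := (b^T *m u) 0 0.
have bu : b^T *m u = s%:M by rewrite [LHS]mx11_scalar.
have ub : u^T *m b = s%:M by apply: trmx_inj; rewrite trmx_mul trmxK bu tr_scalar_mx.
rewrite mulmxBr mulmxBl -scalemxAr -scalemxAl (mulmxA u^T b) ub -(mulmxA s%:M) bu.
rewrite (mulmxDl (x%:M *m b^T)) -(mulmxA x%:M) bu.
rewrite -!scalar_mxM -raddfD/= -scalar_mxM; move: (u^T *m D *m u) => q.
by rewrite !mxE eqxx !mulr1n; field; exact: a0.
Qed.

Lemma det_schur d (N : 'M[R]_(1 + d)) : N^T = N -> N 0 0 != 0 ->
  \det N = N 0 0 * \det (schur N).
Proof.
move=> sN a0.
(* Gaussian elimination: [L] has determinant [1] and clears the first column below the pivot. *)
pose L : 'M[R]_(1 + d) := block_mx 1%:M 0 (- (N 0 0)^-1 *: dlsubmx N) 1%:M.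
have dL : \det L = 1 by rewrite /L det_lblock !det1 mulr1.
rewrite -[LHS]mul1r -dL -det_mulmx {1}(sym_block sN) /L mulmx_block.
rewrite !mul1mx !mul0mx !addr0 mul_mx_scalar scalerA mulrN divff// scaleN1r addNr.
by rewrite det_ublock det_scalar1 /schur -scalemxAl scaleNr addrC.
Qed.

Lemma posdef_pivot d (N : 'M[R]_(1 + d)) : posdef N -> 0 < N 0 0.
Proof.
move=> [sN pN]; have := pN (delta_mx 0 0).
rewrite /qform trmx_delta -rowE -colE !mxE; apply.
by apply/eqP => /matrixP/(_ 0 0)/eqP; rewrite !mxE !eqxx oner_eq0.
Qed.

Lemma posdef_schur d (N : 'M[R]_(1 + d)) : posdef N -> posdef (schur N).
Proof.
move=> pN; have a0 := posdef_pivot pN; case: pN => sN pN; split.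
  rewrite /schur linearB/= linearZ/= trmx_mul trmxK trmx_drsub sN; done.
(* This first coordinate makes the completed square vanish, leaving only the Schur complement. *)
move=> u u0; have := pN (col_mx (- pivot_shift N u)%:M u).
rewrite qform_schur ?gt_eqF// addNr expr0n/= mulr0 add0r; apply.
by apply: contra u0 => /eqP/(congr1 dsubmx); rewrite col_mxKd linear0 => ->.
Qed.

End QuadraticForm.

(** * Independent coordinates built by induction on the dimension *)

Section RandomVector.
Context {R : realType}.

Definition gaussC : R := 3 / 2 * Num.sqrt pi.

(* [d] independent coordinates of law [tri2 * unif11]: the density [W] is kept
   apart from [mu] so that no measure with density has to be constructed. *)
Record tri2_vector (d : nat) disp (O : measurableType disp) (mu : subprobability O R)
    (W : O -> R) (t : O -> 'cV[R]_d) : Prop := {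
  tri2v_bmeas : bmeas W ;
  tri2v_ge0 : forall w, 0 <= W w ;
  tri2v_measurable : forall i, measurable_fun setT (fun w => t w i 0) ;
  tri2v_supp : forall w i, W w != 0 -> `|t w i 0| <= 1 ;
  tri2v_cos : forall (y : 'I_d -> R) c,
    \int[mu]_w (W w * cos (\sum_i t w i 0 * y i + c)) = (\prod_i kker (y i)) * cos c ;
  tri2v_gauss : forall N : 'M[R]_d, posdef N ->
    \int[mu]_w (W w * expR (- qform N (t w))) <= gaussC ^+ d / Num.sqrt (\det N) }.

Lemma measurable_qform d disp (O : measurableType disp) (t : O -> 'cV[R]_d) (N : 'M[R]_d) :
  (forall i, measurable_fun setT (fun w => t w i 0)) ->
  measurable_fun setT (fun w => qform N (t w)).
Proof.
move=> mt; under eq_fun do rewrite qformE.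
apply: measurable_fun_bigsum => j; apply: measurable_fun_bigsum => i.
by apply: measurable_funM => //; apply: measurable_funM.
Qed.

Lemma tri2_vector0 : tri2_vector (dirac tt : probability unit R) (cst 1) (fun=> 0 : 'cV[R]_0).
Proof.
split => //.
- exact: bmeas_cst.
- by move=> w [].
- move=> y c; under eq_Rintegral do rewrite big_ord0 add0r mul1r.
  by rewrite Ex_prob_cst big_ord0 mul1r.
- move=> N _; under eq_Rintegral do rewrite qformE big_ord0 oppr0 expR0 mul1r.
  by rewrite Ex_prob_cst det_mx00 sqrtr1 expr0 divr1.
Qed.

Definition consv d (x : R) (u : 'cV[R]_d) : 'cV[R]_d.+1 := col_mx (x%:M : 'cV[R]_1) u.

Lemma consv0 d x (u : 'cV[R]_d) : consv x u ord0 0 = x.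
Proof.
by rewrite mxE; case: fintype.splitP => // j _; rewrite mxE !ord1.
Qed.

Lemma consvS d x (u : 'cV[R]_d) i : consv x u (lift ord0 i) 0 = u i 0.
Proof.
rewrite mxE; case: fintype.splitP => [[[|j] jP]|j [ij]]//.
by congr (u _ _); exact: val_inj.
Qed.

(** The two integral formulas use opposite orders of integration. For cosines the old coordinates
    are integrated first, the new one being part of the phase. For Gaussians the new coordinate is
    integrated first, after completing the square, which leaves the Schur complement for the
    induction hypothesis. *)
Lemma tri2_vectorS d disp (O : measurableType disp) (mu : subprobability O R)
    (W : O -> R) (t : O -> 'cV[R]_d) : tri2_vector mu W t ->
  tri2_vector (product_subprobability (unif11 : subprobability _ R, mu))
    (fun z => tri2 z.1 * W z.2) (fun z => consv z.1 (t z.2)).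
Proof.
move=> [bW W0 mt st ct gt].
have bt1 : bmeas (fun z : measurableTypeR R * O => tri2 z.1).
  by apply: (bmeas_comp bmeas_tri2); exact: measurable_fst.
have bW2 : bmeas (fun z : measurableTypeR R * O => W z.2).
  by apply: (bmeas_comp bW); exact: measurable_snd.
have bW' := bmeasM bt1 bW2.
have mt' (i : 'I_d.+1) : measurable_fun setT
    (fun z : measurableTypeR R * O => consv z.1 (t z.2) i 0).
  case: (unliftP ord0 i) => [j|] ->.
    under eq_fun do rewrite consvS.
    exact: (measurableT_comp (mt j) measurable_snd).
  under eq_fun do rewrite consv0.
  exact: measurable_fst.
split => //.
- by move=> w; rewrite mulr_ge0 ?tri2_ge0.
- move=> w i; rewrite mulf_eq0 negb_or => /andP[w1 w2].
  case: (unliftP ord0 i) => [j|] ->; first by rewrite consvS st.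
  rewrite consv0 leNgt; apply: contra w1 => h.
  by rewrite tri2_out.
- move=> y c.
  have bf : bmeas (fun z : measurableTypeR R * O => tri2 z.1 * W z.2 *
      cos (\sum_(i < d.+1) consv z.1 (t z.2) i 0 * y i + c)).
    apply: bmeasM => //; apply: bmeas_cos; apply: measurable_funD => //.
    by apply: measurable_fun_bigsum => i; apply: measurable_funM => //; exact: mt'.
  rewrite -(Ex_prod2 unif11 mu bf) /=.
  transitivity (\int[unif11]_x ((\prod_(i < d) kker (y (lift ord0 i))) *
      (tri2 x * cos (x * y ord0 + c)))).
    apply: eq_Rintegral => x _.
    transitivity (\int[mu]_w (tri2 x *
        (W w * cos (\sum_i t w i 0 * y (lift ord0 i) + (x * y ord0 + c))))).
      apply: eq_Rintegral => w _; rewrite big_ord_recl consv0 -mulrA.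
      by under eq_bigr do rewrite consvS; rewrite addrA [_ + x * _]addrC.
    rewrite ExZ.
      by rewrite (ct (fun i => y (lift ord0 i))) mulrCA.
    apply: bmeasM => //; apply: bmeas_cos; apply: measurable_funD => //.
    by apply: measurable_fun_bigsum => i; apply: measurable_funM.
  rewrite ExZ; last first.
    by apply: bmeasM; [exact: bmeas_tri2|apply: bmeas_cos; exact: measurable_affine].
  by rewrite Ex_tri2_cos big_ord_recl mulrA [X in X * _]mulrC.
- move=> N pN; have [sN _] := pN.
  have a0 : 0 < N ord0 ord0 by exact: (@posdef_pivot R d N).
  have pS : posdef (schur N) by exact: posdef_schur.
  have bf : bmeas (fun z : measurableTypeR R * O => tri2 z.1 * W z.2 *
      expR (- qform N (consv z.1 (t z.2)))).
    apply: bmeasM => //; apply: bmeas_expN => [|z]; last exact: posdef_qform_ge0.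
    exact: measurable_qform.
  rewrite -(Ex_prod2 unif11 mu bf) (Ex_swap unif11 mu bf) /=.
  have bS : bmeas (fun w => W w * expR (- qform (schur N) (t w))).
    apply: bmeasM => //; apply: bmeas_expN => [|z]; last exact: posdef_qform_ge0.
    exact: measurable_qform.
  apply: (@le_trans _ _ (\int[mu]_w ((W w * expR (- qform (schur N) (t w))) *
      (gaussC / Num.sqrt (N ord0 ord0))))).
    have b1 := bmeas_Ex1 unif11 mu bf.
    apply: Ex_le; [exact: b1|by apply: bmeasM => //; exact: bmeas_cst|].
    move=> w.
    apply: (@le_trans _ _ (\int[unif11]_x ((W w * expR (- qform (schur N) (t w))) *
        (tri2 x * expR (- (N ord0 ord0 * (x + pivot_shift N (t w)) ^+ 2)))))).
      rewrite le_eqVlt; apply/orP; left; apply/eqP; apply: eq_Rintegral => x _ /=.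
      rewrite /consv (@qform_schur R d N) ?gt_eqF// opprD expRD; ring.
    rewrite ExZ.
      by rewrite ler_wpM2l ?mulr_ge0 ?expR_ge0// Ex_tri2_gauss.
    apply: bmeasM; first exact: bmeas_tri2.
    apply: bmeas_expN => [|x]; last by rewrite mulr_ge0 ?sqr_ge0// ltW.
    by apply: measurable_funM => //; apply: measurable_funX; apply: measurable_funD.
  rewrite ExZr// (@det_schur R d N) ?gt_eqF// sqrtrM ?(ltW a0)// exprS invfM.
  apply: (@le_trans _ _ (gaussC ^+ d / Num.sqrt (\det (schur N)) *
      (gaussC / Num.sqrt (N ord0 ord0)))).
    apply: ler_wpM2r; last exact: gt.
    by rewrite divr_ge0 ?sqrtr_ge0// mulr_ge0 ?sqrtr_ge0.
  rewrite le_eqVlt; apply/orP; left; apply/eqP.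
  rewrite (_ : N 0 0 = N ord0 ord0)//; ring.
Qed.

Lemma tri2_vector_exists d : exists disp (O : measurableType disp)
  (mu : subprobability O R) (W : O -> R) (t : O -> 'cV[R]_d), tri2_vector mu W t.
Proof.
elim: d => [|d [disp [Om [mu [W [t H]]]]]].
  by do 5 eexists; exact: tri2_vector0.
by do 5 eexists; exact: tri2_vectorS H.
Qed.

End RandomVector.

(** * Independence and characteristic functions *)

Section Quantization.
Context {R : realType}.
Implicit Types x : R.

Definition qbin (m j : nat) : set R := `[j%:R / m%:R - 1, j.+1%:R / m%:R - 1[%classic.

(** Rounding down to multiples of [1 / m]. The bins are half-open, so the value [1] needs a bin of
    its own: [2 m + 1] of them rather than [2 m]. *)
Definition quant (m : nat) x : R :=
  \sum_(j < (2 * m).+1) (j%:R / m%:R - 1) * \1_(qbin m j) x.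

Lemma quantE m x : (0 < m)%N -> `|x| <= 1 ->
  exists j : 'I_(2 * m).+1, quant m x = j%:R / m%:R - 1 /\ qbin m j x.
Proof.
move=> m0; rewrite ler_norml => /andP[x1 x2].
have mp : 0 < m%:R :> R by rewrite ltr0n.
pose y := m%:R * (x + 1).
have y0 : 0 <= y by apply: mulr_ge0; [exact: ltW | lra].
have /andP[yl yr] := truncn_itv y0.
have jb : (Num.truncn y < (2 * m).+1)%N.
  rewrite ltnS -(ler_nat R) natrM (le_trans yl)// /y [leRHS]mulrC.
  by apply: ler_wpM2l; [exact: ltW | lra].
have binP (j : nat) : qbin m j x <-> j%:R <= y < j.+1%:R.
  rewrite /qbin/= in_itv/= lerBlDr ltrBrDr ler_pdivrMr// ltr_pdivlMr//.
  by rewrite /y [m%:R * _]mulrC.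
exists (Ordinal jb); split; last by apply/binP; rewrite yl.
rewrite /quant (bigD1 (Ordinal jb))//= big1 ?addr0.
  by rewrite indicE mem_set ?mulr1//; apply/binP; rewrite yl.
move=> j jj; rewrite indicE memNset ?mulr0// => /binP /andP[jl jr].
move/eqP: jj; apply; apply/val_inj/eqP => /=; rewrite eqn_leq.
by rewrite -ltnS -(ltr_nat R) (le_lt_trans jl yr)/= -ltnS -(ltr_nat R) (le_lt_trans yl jr).
Qed.

Lemma quant_close m x : (0 < m)%N -> `|x| <= 1 -> `|quant m x - x| <= m%:R^-1.
Proof.
move=> m0 x1; have [j [->]] := quantE m0 x1.
rewrite /qbin/= in_itv/= -natr1 mulrDl mul1r => /andP[a b].
by rewrite ler_norml; apply/andP; split; lra.
Qed.

Lemma quant_le1 m x : (0 < m)%N -> `|x| <= 1 -> `|quant m x| <= 1.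
Proof.
move=> m0 x1; have [j [-> _]] := quantE m0 x1.
have mp : 0 < m%:R :> R by rewrite ltr0n.
have j0 : 0 <= j%:R / m%:R :> R by rewrite divr_ge0.
have j1 : j%:R / m%:R <= 2 :> R.
  by rewrite ler_pdivrMr// -natrM ler_nat -ltnS.
by rewrite ler_norml; apply/andP; split; lra.
Qed.

Lemma measurable_qbin m j : measurable (qbin m j).
Proof. exact: measurable_itv. Qed.

(** Factors are exchanged one at a time; each exchange costs at most [e] because all other factors
    are bounded by [1]. *)
Lemma dist_prod_le (I : Type) (r : seq I) (a b : I -> R) e :
  (forall i, `|a i| <= 1) -> (forall i, `|b i| <= 1) -> (forall i, `|a i - b i| <= e) ->
  `|\prod_(i <- r) a i - \prod_(i <- r) b i| <= (size r)%:R * e.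
Proof.
move=> a1 b1 ab; elim: r => [|i r IH].
  by rewrite !big_nil subrr normr0 mul0r.
rewrite !big_cons /= -natr1 mulrDl mul1r.
set A := \prod_(i <- r) a i in IH *; set B := \prod_(i <- r) b i in IH *.
have -> : a i * A - b i * B = a i * (A - B) + (a i - b i) * B by ring.
apply: le_trans (ler_normD _ _) _; rewrite !normrM; apply: lerD.
  by apply: le_trans IH; rewrite ler_piMl.
apply: le_trans (ab i); rewrite ler_piMr// /B normr_prod.
by elim: (r) => [|k s IHs]; rewrite ?big_nil// big_cons mulr_ile1// prodr_ge0.
Qed.

End Quantization.

Lemma le_inv_nat_eq0 (R : realType) (x K : R) : (forall m, (0 < m)%N -> `|x| <= K / m%:R) -> x = 0.
Proof.
move=> h; apply/eqP; rewrite -normr_eq0; apply/negPn/negP => x0.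
have xp : 0 < `|x| by rewrite lt_neqAle eq_sym x0 normr_ge0.
have := h (Num.truncn (K / `|x|)).+1 isT.
rewrite ler_pdivlMr ?ltr0n// mulrC -ler_pdivlMr// => h1.
have := truncnS_gt (K / `|x|); lra.
Qed.

Section Independence.
Context d (T : measurableType d) {R : realType} (P : probability T R).

Lemma Ex_indic (A : set T) : measurable A -> \int[P]_w \1_A w = fine (P A).
Proof. by move=> mA; rewrite /Rintegral integral_indic// setIT. Qed.

Lemma bmeas_indic (A : set T) : measurable A -> bmeas (\1_A : T -> R).
Proof.
move=> mA; split; first exact: measurable_indic.
by exists 1 => x; rewrite indicE; case: (_ \in _); rewrite ?normr1 ?normr0.
Qed.

Lemma bmeas_indic_comp (G : T -> R) (B : set R) : measurable_fun setT G -> measurable B ->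
  bmeas (fun w => \1_B (G w) : R).
Proof.
move=> mG mB; split; first exact: measurableT_comp mG.
by exists 1 => x; rewrite indicE; case: (_ \in _); rewrite ?normr1 ?normr0.
Qed.

Lemma bmeas_quant m (G : T -> R) : measurable_fun setT G -> bmeas (fun w => quant m (G w)).
Proof.
move=> mG; apply: bmeas_sum => j; apply: bmeasM; first exact: bmeas_cst.
by apply: bmeas_indic_comp => //; exact: measurable_qbin.
Qed.

Lemma bmeas_le1 (G : T -> R) : measurable_fun setT G -> (forall w, `|G w| <= 1) -> bmeas G.
Proof. by move=> mG G1; split => //; exists 1. Qed.

Lemma Ex_quant_close m (G : T -> R) : (0 < m)%N -> measurable_fun setT G ->
  (forall w, `|G w| <= 1) -> `|\int[P]_w quant m (G w) - \int[P]_w G w| <= m%:R^-1.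
Proof.
move=> m0 mG G1; rewrite -(ExB P (bmeas_quant m mG) (bmeas_le1 mG G1)).
apply: Ex_norm_le; first by apply: bmeasB; [exact: bmeas_quant|exact: bmeas_le1].
  by rewrite invr_ge0.
by move=> w; exact: quant_close.
Qed.

Lemma measurable_preimage (G : T -> R) (B : set R) : measurable_fun setT G -> measurable B ->
  measurable (G @^-1` B).
Proof. by move=> mG mB; rewrite -[X in measurable X]setTI; exact: mG. Qed.

Lemma Ex_quant m (G : T -> R) : measurable_fun setT G ->
  \int[P]_w quant m (G w) =
  \sum_(j < (2 * m).+1) (j%:R / m%:R - 1) * fine (P (G @^-1` qbin m j)).
Proof.
move=> mG; rewrite Ex_sum; last first.
  move=> j; apply: bmeasM; first exact: bmeas_cst.
  by apply: bmeas_indic_comp => //; exact: measurable_qbin.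
apply: eq_bigr => j _; rewrite ExZ; last first.
  by apply: bmeas_indic_comp => //; exact: measurable_qbin.
by rewrite -Ex_indic//; apply: measurable_preimage => //; exact: measurable_qbin.
Qed.

(** The expectation of a quantized variable is a finite sum of probabilities, where the hypothesis
    applies directly; quantization changes each side by at most [1 / m]. *)
Lemma Ex_same_law (G H : T -> R) : measurable_fun setT G -> measurable_fun setT H ->
  (forall w, `|G w| <= 1) -> (forall w, `|H w| <= 1) ->
  (forall B, measurable B -> P (G @^-1` B) = P (H @^-1` B)) ->
  \int[P]_w G w = \int[P]_w H w.
Proof.
move=> mG mH G1 H1 GH; apply/eqP; rewrite -subr_eq0; apply/eqP.
apply: (@le_inv_nat_eq0 _ _ 2) => m m0.
have := Ex_quant_close m0 mG G1; have := Ex_quant_close m0 mH H1.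
have -> : \int[P]_w quant m (G w) = \int[P]_w quant m (H w).
  rewrite !Ex_quant//; apply: eq_bigr => j _.
  by rewrite GH//; exact: measurable_qbin.
by rewrite !ler_norml => /andP[a1 a2] /andP[b1 b2]; apply/andP; split; lra.
Qed.

(** Independence is given for events. Quantization reduces expectations to finite combinations of
    probabilities of events, with an error of order [1 / m] on both sides. *)
Lemma Ex_indep_prod (I : finType) (G : I -> T -> R) :
  (forall i, measurable_fun setT (G i)) -> (forall i w, `|G i w| <= 1) ->
  (forall B : I -> set R, (forall i, measurable (B i)) ->
    P [set w | forall i, B i (G i w)] = (\prod_i P (G i @^-1` B i))%E) ->
  \int[P]_w (\prod_i G i w) = \prod_i \int[P]_w G i w.
Proof.
move=> mG G1 ind; apply/eqP; rewrite -subr_eq0; apply/eqP.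
pose n : R := (size (index_enum I))%:R.
apply: (@le_inv_nat_eq0 _ _ (2 * n)) => m m0.
have m0' : 0 <= m%:R^-1 :> R by rewrite invr_ge0.
(* Both sides expand into a sum over the choices [f] of one bin per index, and the hypothesis
   identifies them term by term. *)
have Qind : \int[P]_w (\prod_i quant m (G i w)) = \prod_i \int[P]_w quant m (G i w).
  under eq_Rintegral do rewrite bigA_distr_bigA/=.
  under [RHS]eq_bigr do rewrite Ex_quant//.
  rewrite bigA_distr_bigA/= Ex_sum; last first.
    move=> f; apply: bmeas_prod => i; apply: bmeasM; first exact: bmeas_cst.
    by apply: bmeas_indic_comp => //; exact: measurable_qbin.
  apply: eq_bigr => f _.
  under eq_Rintegral do rewrite big_split/=.
  rewrite big_split/= ExZ; last first.
    apply: bmeas_prod => i.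
    by apply: bmeas_indic_comp => //; exact: measurable_qbin.
  congr (_ * _).
  pose A := [set w | forall i, qbin m (f i) (G i w)].
  have EA : P A = (\prod_i fine (P (G i @^-1` qbin m (f i))))%:E.
    rewrite /A (ind (fun i => qbin m (f i))); last by move=> i; exact: measurable_qbin.
    rewrite -prodEFin; apply: eq_bigr => i _; rewrite fineK//.
    by apply: fin_num_measure; apply: measurable_preimage => //; exact: measurable_qbin.
  rewrite -[RHS]/(fine (_%:E)) -EA -Ex_indic; last first.
    rewrite (_ : A = \big[setI/setT]_i (G i @^-1` qbin m (f i))).
      apply: bigsetI_measurable => i _.
      by apply: measurable_preimage => //; exact: measurable_qbin.
    apply/seteqP; split => [w wA|w].
      by rewrite -bigcap_seq => i _; exact: wA.
    by rewrite -bigcap_seq => wA i; apply: wA; rewrite /= mem_index_enum.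
  apply: eq_Rintegral => w _; rewrite indicE.
  have [wA|wA] := boolP (w \in A).
    by rewrite big1// => i _; rewrite indicE mem_set//; move: wA; rewrite inE.
  apply/eqP; rewrite prodf_seq_eq0; apply/hasP.
  move: wA; rewrite notin_setE => /existsNP[i wi]; exists i; first exact: mem_index_enum.
  by rewrite /= indicE memNset.
have d1 : `|\int[P]_w (\prod_i quant m (G i w)) - \int[P]_w (\prod_i G i w)| <= n * m%:R^-1.
  have b1 : bmeas (fun w => \prod_i quant m (G i w)).
    by apply: bmeas_prod => i; exact: bmeas_quant.
  have b2 : bmeas (fun w => \prod_i G i w) by apply: bmeas_prod => i; exact: bmeas_le1.
  rewrite -ExB//; apply: Ex_norm_le; first exact: bmeasB.
    by rewrite mulr_ge0.
  move=> w; apply: dist_prod_le => i; [exact: quant_le1|exact: G1|exact: quant_close].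
have d2 : `|\prod_i \int[P]_w quant m (G i w) - \prod_i \int[P]_w G i w| <= n * m%:R^-1.
  apply: dist_prod_le => i.
  - apply: Ex_norm_le => //; first exact: bmeas_quant.
    by move=> w; exact: quant_le1.
  - by apply: Ex_norm_le => //; exact: bmeas_le1.
  - exact: Ex_quant_close.
move: d1 d2; rewrite Qind !ler_norml => /andP[a1 a2] /andP[b1 b2].
by apply/andP; split; lra.
Qed.

End Independence.

(** * The characteristic function of a sum of independent variables *)

Section Cis.
Context {R : rcfType}.
Local Open Scope complex_scope.

Definition sqnc (z : R[i]) : R := complex.Re z ^+ 2 + complex.Im z ^+ 2.

Lemma sqncM : {morph sqnc : z w / z * w}.
Proof. by move=> [a b] [c d]; rewrite /sqnc /=; ring. Qed.

Lemma sqnc1 : sqnc 1 = 1.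
Proof. by rewrite /sqnc/= expr1n expr0n addr0. Qed.

Lemma Re_sum (I : Type) (r : seq I) (F : I -> R[i]) :
  complex.Re (\sum_(i <- r) F i) = \sum_(i <- r) complex.Re (F i).
Proof. by elim/big_rec2: _ => // i x y _ <-; case: (F i) y => a b [c d]. Qed.

End Cis.

Section CharacteristicFunction.
Context {R : realType}.
Local Open Scope complex_scope.

Definition cis (x : R) : R[i] := cos x +i* sin x.

Lemma cisD x y : cis (x + y) = cis x * cis y.
Proof. by rewrite /cis cosD sinD; apply/eqP; rewrite eq_complex/= addrC; apply/andP; split; apply/eqP; ring. Qed.

Lemma cis_sum (I : Type) (r : seq I) (F : I -> R) :
  cis (\sum_(i <- r) F i) = \prod_(i <- r) cis (F i).
Proof.
elim: r => [|i r IH]; first by rewrite !big_nil /cis cos0 sin0.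
by rewrite !big_cons cisD IH.
Qed.

Definition trig (b : bool) (x : R) : R := if b then cos x else sin x.

Let unitc (b : bool) : R[i] := if b then 1 else 'i.

(** Choosing the real or the imaginary part in each factor writes a complex product through real
    products, so only real functions are ever integrated. *)
Lemma prod_complex_expand (I : finType) (u : I -> bool -> R) :
  \prod_i (u i true +i* u i false) =
  \sum_(f : {ffun I -> bool}) (\prod_i unitc (f i)) * (\prod_i u i (f i))%:C.
Proof.
transitivity (\prod_i \sum_(b : bool) unitc b * (u i b)%:C).
  apply: eq_bigr => i _; rewrite big_bool /unitc.
  by apply/eqP; rewrite eq_complex/=; apply/andP; split; apply/eqP; ring.
rewrite bigA_distr_bigA/=; apply: eq_bigr => f _.
by rewrite big_split/= rmorph_prod.
Qed.

Lemma Re_mul_real (z : R[i]) (x : R) : complex.Re (z * x%:C) = complex.Re z * x.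
Proof. by case: z => a b /=; rewrite mulr0 subr0. Qed.

(** The left side is the square of the real part of [Z], the characteristic function of the sum
    rotated by [c]; the right side is its squared modulus. *)
Lemma Ex_cos_sum_le d (T : measurableType d) (P : probability T R) (I : finType)
    (th : I -> T -> R) (c : R) :
  (forall i, measurable_fun setT (th i)) ->
  (forall B : I -> set R, (forall i, measurable (B i)) ->
    P [set w | forall i, B i (th i w)] = (\prod_i P (th i @^-1` B i))%E) ->
  (\int[P]_w cos (\sum_i th i w + c)) ^+ 2 <=
  \prod_i ((\int[P]_w cos (th i w)) ^+ 2 + (\int[P]_w sin (th i w)) ^+ 2).
Proof.
move=> mth ind.
have mtrig b : measurable_fun setT (trig b).
  by apply: continuous_measurable_fun; case: b; [exact: continuous_cos | exact: continuous_sin].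
have mt i b : measurable_fun setT (fun w => trig b (th i w)).
  exact: (measurableT_comp (mtrig b) (mth i)).
have t1 (b : bool) x : `|trig b x| <= 1 by case: b; [exact: cos_max | exact: sin_max].
pose e (i : I) b : R := \int[P]_w trig b (th i w).
pose Z := cis c * \prod_i (e i true +i* e i false).
have -> : \int[P]_w cos (\sum_i th i w + c) = complex.Re Z.
  transitivity (\int[P]_w \sum_(f : {ffun I -> bool})
      (complex.Re (cis c * \prod_i unitc (f i)) * \prod_i trig (f i) (th i w))).
    apply: eq_Rintegral => w _.
    rewrite -[LHS]/(complex.Re (cis (\sum_i th i w + c))) addrC cisD cis_sum.
    rewrite (prod_complex_expand (fun i b => trig b (th i w))) mulr_sumr Re_sum.
    by apply: eq_bigr => f _; rewrite mulrA Re_mul_real.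
  rewrite Ex_sum; last first.
    move=> f; apply: bmeasM; first exact: bmeas_cst.
    by apply: bmeas_prod => i; exact: bmeas_le1.
  rewrite /Z (prod_complex_expand e) mulr_sumr Re_sum.
  apply: eq_bigr => f _; rewrite mulrA Re_mul_real ExZ; last first.
    by apply: bmeas_prod => i; exact: bmeas_le1.
  congr (_ * _); rewrite (@Ex_indep_prod _ _ _ P I (fun i w => trig (f i) (th i w)))//.
  move=> B mB; rewrite (ind (fun i => trig (f i) @^-1` B i))// => i.
  exact: measurable_preimage.
have -> : \prod_i ((\int[P]_w cos (th i w)) ^+ 2 + (\int[P]_w sin (th i w)) ^+ 2) = sqnc Z.
  rewrite sqncM (big_morph _ sqncM sqnc1) /sqnc /= cos2Dsin2 mul1r.
  by apply: eq_bigr.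
by rewrite /sqnc lerDl sqr_ge0.
Qed.

(* [|phi s|^2] is the characteristic function at [s] of the symmetrized variable. *)
Lemma Ex_cos_sin_sqr d (T : measurableType d) (P : probability T R) (Y : T -> R) (s : R) :
  measurable_fun setT Y ->
  (\int[P]_w cos (s * Y w)) ^+ 2 + (\int[P]_w sin (s * Y w)) ^+ 2 =
  \int[P]_w \int[P]_w' cos (s * (Y w - Y w')).
Proof.
move=> mY.
have ms : measurable_fun setT (fun w => s * Y w) by exact: measurable_funM.
have bc := bmeas_cos ms; have bs := bmeas_sin ms.
transitivity (\int[P]_w (cos (s * Y w) * (\int[P]_w' cos (s * Y w')) +
   sin (s * Y w) * (\int[P]_w' sin (s * Y w')))).
  by rewrite ExD; [rewrite !ExZr// !expr2|apply: bmeasM => //; exact: bmeas_cst..].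
apply: eq_Rintegral => w _; rewrite -!ExZ// -ExD; last 2 first.
- by apply: bmeasM => //; exact: bmeas_cst.
- by apply: bmeasM => //; exact: bmeas_cst.
by apply: eq_Rintegral => w' _; rewrite mulrBr cosB.
Qed.

End CharacteristicFunction.

(** * Positive combinations of cosines *)

Section ExpLimit.
Context {R : realType}.
Implicit Types x g G : R.

Lemma bernoulli_ineq x m : 0 <= x <= 1 -> 1 - m%:R * x <= (1 - x) ^+ m.
Proof.
move=> /andP[x0 x1].
elim: m => [|m IH]; first by rewrite mul0r subr0 expr0.
have h : 0 <= 1 - x by lra.
have m0 : 0 <= m%:R :> R by [].
rewrite exprS -natr1; have := ler_wpM2l h IH.
have : 0 <= m%:R * x * x by rewrite !mulr_ge0.
lra.
Qed.

(** With [x = g / m], [1 - x <= exp (- x)] gives [(1 - x^2) exp x <= 1 + x]; then take [m]-th powers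
    and apply Bernoulli. The power [(1 + g / m)^m] matters because it stays among finite nonnegative
    combinations of cosines when [g] is one, whereas [exp g] need not. *)
Lemma exp_approx g G m : (0 < m)%N -> `|g| <= G -> G <= m%:R ->
  (1 - G ^+ 2 / m%:R) * expR g <= (1 + g / m%:R) ^+ m <= expR g /\ 0 <= 1 + g / m%:R.
Proof.
move=> m0 gG Gm; have mp : 0 < m%:R :> R by rewrite ltr0n.
pose x := g / m%:R.
have x1 : `|x| <= 1.
  by rewrite normrM normfV (ger0_norm (ltW mp)) ler_pdivrMr// mul1r (le_trans gG).
have x0 : 0 <= 1 + x by move: x1; rewrite ler_norml; lra.
have gE : g = m%:R * x by rewrite /x mulrC divfK// gt_eqF.
have eE : expR g = expR x ^+ m by rewrite -expRM_natl -gE.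
rewrite -/x; split=> //; apply/andP; split; last first.
  by rewrite eE lerXn2r ?nnegrE ?expR_ge0//; exact: expR_ge1Dx.
have h1 : (1 - x ^+ 2) * expR x <= 1 + x.
  have e1 : 1 - x <= expR (- x) by have := expR_ge1Dx (- x).
  have := ler_wpM2l x0 e1.
  have -> : (1 + x) * (1 - x) = 1 - x ^+ 2 by ring.
  move=> /(ler_wpM2r (expR_ge0 x)); rewrite -mulrA [expR (- x) * _]mulrC expRxMexpNx_1 mulr1.
  done.
have x2 : x ^+ 2 <= 1 by rewrite -real_normK ?num_real// exprn_ile1.
have h2 : 1 - m%:R * x ^+ 2 <= (1 - x ^+ 2) ^+ m by rewrite bernoulli_ineq// sqr_ge0.
apply: (@le_trans _ _ ((1 - x ^+ 2) ^+ m * expR g)).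
  apply: ler_wpM2r; first exact: expR_ge0.
  apply: le_trans h2; rewrite lerD2l lerN2.
  have -> : m%:R * x ^+ 2 = g ^+ 2 / m%:R by rewrite /x; field; rewrite gt_eqF.
  rewrite ler_wpM2r ?invr_ge0 ?(ltW mp)// -(@real_normK R g) ?num_real//.
  by rewrite lerXn2r ?nnegrE// (le_trans _ gG).
rewrite eE -exprMn lerXn2r ?nnegrE// mulr_ge0 ?expR_ge0//; lra.
Qed.

End ExpLimit.

Section PositiveCosineCombinations.
Context {R : realType}.

(** At [RR], this and the later [dotnorm] and [gram] are convertible to [inner], [tdot_norm] and
    [Nmat], so the main proof passes between them silently. *)
Definition dotp d (t u : 'cV[R]_d) : R := \sum_i t i 0 * u i 0.

Lemma dotpZl d z (t u : 'cV[R]_d) : dotp (z *: t) u = z * dotp t u.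
Proof. by rewrite /dotp mulr_sumr; apply: eq_bigr => i _; rewrite mxE mulrA. Qed.

Lemma dotpDr d (t u v : 'cV[R]_d) : dotp t (u + v) = dotp t u + dotp t v.
Proof. by rewrite /dotp -big_split/=; apply: eq_bigr => i _; rewrite mxE mulrDr. Qed.

Lemma dotpNr d (t u : 'cV[R]_d) : dotp t (- u) = - dotp t u.
Proof. by rewrite /dotp -sumrN; apply: eq_bigr => i _; rewrite mxE mulrN. Qed.

Lemma dotp0r d (t : 'cV[R]_d) : dotp t 0 = 0.
Proof. by rewrite /dotp big1// => i _; rewrite mxE mulr0. Qed.

Variable d : nat.

Inductive poscos : ('cV[R]_d -> R) -> Prop :=
| poscos_cos p u : 0 <= p -> poscos (fun t => p * cos (dotp t u))
| poscos_add F G : poscos F -> poscos G -> poscos (fun t => F t + G t).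

Lemma poscos_cst p : 0 <= p -> poscos (fun _ => p).
Proof.
move=> p0; have := poscos_cos 0 p0.
by under eq_fun do rewrite dotp0r cos0 mulr1.
Qed.

Lemma poscos_mul F G : poscos F -> poscos G -> poscos (fun t => F t * G t).
Proof.
elim=> [p u p0|F1 F2 _ IH1 _ IH2] pG; last first.
  under eq_fun do rewrite mulrDl.
  by apply: poscos_add; [exact: IH1|exact: IH2].
elim: pG => [q v q0|G1 G2 _ IH1 _ IH2]; last first.
  under eq_fun do rewrite mulrDr.
  exact: poscos_add.
have pq : 0 <= p * q / 2 by rewrite divr_ge0// mulr_ge0.
rewrite (_ : (fun t => _) = fun t : 'cV[R]_d =>
    p * q / 2 * cos (dotp t (u + v)) + p * q / 2 * cos (dotp t (u - v))).
  by apply: poscos_add; exact: poscos_cos.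
by apply/funext => t; rewrite !dotpDr dotpNr cosD cosB; field.
Qed.

Lemma poscos_exp F m : poscos F -> poscos (fun t => F t ^+ m).
Proof.
move=> pF; elim: m => [|m IH].
  by under eq_fun do rewrite expr0; exact: poscos_cst.
by under eq_fun do rewrite exprS; exact: poscos_mul.
Qed.

Lemma poscos_sum (I : Type) (r : seq I) (F : I -> 'cV[R]_d -> R) :
  (forall i, poscos (F i)) -> poscos (fun t => \sum_(i <- r) F i t).
Proof.
move=> pF; elim: r => [|i r IH].
  by under eq_fun do rewrite big_nil; exact: poscos_cst.
by under eq_fun do rewrite big_cons; exact: poscos_add.
Qed.

Context disp (O : measurableType disp) (mu : subprobability O R)
    (W : O -> R) (t : O -> 'cV[R]_d) (tv : tri2_vector mu W t).

Lemma measurable_dotp u : measurable_fun setT (fun w => dotp (t w) u).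
Proof.
apply: measurable_fun_bigsum => i; apply: measurable_funM => //.
exact: (tri2v_measurable tv).
Qed.

Lemma measurable_dotpZ z u : measurable_fun setT (fun w => dotp (z *: t w) u).
Proof.
by under eq_fun do rewrite dotpZl; apply: measurable_funM => //; exact: measurable_dotp.
Qed.

Lemma Ex_cos_dotp z u : \int[mu]_w (W w * cos (dotp (z *: t w) u)) = \prod_i kker (z * u i 0).
Proof.
have := tri2v_cos tv (fun i => z * u i 0) 0; rewrite cos0 mulr1 => <-.
apply: eq_Rintegral => w _; congr (_ * cos _); rewrite addr0 dotpZl /dotp mulr_sumr.
by apply: eq_bigr => i _; rewrite mulrCA.
Qed.

(** The [bmeas] conclusions travel with the inequality because adding two cases requires integrating
    each summand separately. *)
Lemma poscos_scale z F : 1 <= `|z| -> poscos F ->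
  [/\ bmeas (fun w => F (z *: t w)), bmeas (fun w => F (t w)) &
  \int[mu]_w (W w * F (z *: t w)) <= 6 ^+ d * \int[mu]_w (W w * F (t w))].
Proof.
move=> z1; have bW := tri2v_bmeas tv.
elim=> [p u p0|F1 F2 _ [a1 b1 c1] _ [a2 b2 c2]]; split.
- by apply: bmeasM; [exact: bmeas_cst | apply: bmeas_cos; exact: measurable_dotpZ].
- by apply: bmeasM; [exact: bmeas_cst | apply: bmeas_cos; exact: measurable_dotp].
- under eq_Rintegral do rewrite mulrCA.
  under [X in _ <= _ * X]eq_Rintegral do rewrite mulrCA -(scale1r (t _)).
  rewrite !ExZ; last 2 first.
    by apply: bmeasM => //; apply: bmeas_cos; exact: measurable_dotpZ.
    by apply: bmeasM => //; apply: bmeas_cos; exact: measurable_dotpZ.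
  rewrite !Ex_cos_dotp mulrCA ler_wpM2l//.
  rewrite -[X in _ <= X ^+ _ * _]/6 -[X in 6 ^+ X](card_ord d) -prodr_const -big_split/=.
  apply: ler_prod => i _; rewrite kker_ge0 mul1r; exact: kker_scale.
- exact: bmeasD.
- exact: bmeasD.
- under eq_Rintegral do rewrite mulrDr.
  under [X in _ <= _ * X]eq_Rintegral do rewrite mulrDr.
  rewrite !ExD; try exact: bmeasM.
  by rewrite mulrDr lerD.
Qed.

Lemma exp_cos_scale (I : finType) (a : I -> 'cV[R]_d) b z : 0 <= b -> 1 <= `|z| ->
  \int[mu]_w (W w * expR (b * \sum_k cos (dotp (z *: t w) (a k)))) <=
  6 ^+ d * \int[mu]_w (W w * expR (b * \sum_k cos (dotp (t w) (a k)))).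
Proof.
move=> b0 z1; have bW := tri2v_bmeas tv; have W0 := tri2v_ge0 tv.
pose g (v : 'cV[R]_d) := b * \sum_k cos (dotp v (a k)).
pose G := b * #|I|%:R.
have G0 : 0 <= G by rewrite mulr_ge0.
have gG v : `|g v| <= G.
  rewrite /g normrM (ger0_norm b0) ler_wpM2l//.
  rewrite (le_trans (ler_norm_sum _ _ _))// -sum1_card natr_sum ler_sum// => i _.
  exact: cos_max.
have bg z' : bmeas (fun w => W w * expR (g (z' *: t w))).
  apply: bmeasM => //; apply: bmeas_exp; apply: bmeasM; first exact: bmeas_cst.
  by apply: bmeas_sum => k; apply: bmeas_cos; exact: measurable_dotpZ.
have bg1 : bmeas (fun w => W w * expR (g (t w))).
  by have := bg 1; under eq_fun do rewrite scale1r.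
set L := (X in X <= _); set U := \int[mu]_w _.
have L0 : 0 <= L by apply: Ex_ge0 => w; rewrite mulr_ge0 ?expR_ge0.
(* A quantitative form of the limit: the lower bound of [exp_approx] is used at [z t], the upper
   bound at [t]. *)
have key m : (0 < m)%N -> G <= m%:R -> (1 - G ^+ 2 / m%:R) * L <= 6 ^+ d * U.
  move=> m0 Gm.
  pose F v := (1 + g v / m%:R) ^+ m.
  have pF : poscos F.
    apply: poscos_exp; apply: poscos_add; first exact: poscos_cst.
    rewrite /g; under eq_fun do rewrite mulrAC mulr_sumr.
    by apply: poscos_sum => k; apply: poscos_cos; rewrite divr_ge0.
  have [bz b1 le] := poscos_scale z1 pF.
  apply: (@le_trans _ _ (\int[mu]_w (W w * F (z *: t w)))).
    rewrite -ExZ; last exact: bg.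
    apply: Ex_le; [apply: bmeasM; [exact: bmeas_cst|exact: bg]|exact: bmeasM|].
    move=> w; rewrite mulrCA ler_wpM2l//.
    by have [/andP[]] := exp_approx m0 (gG (z *: t w)) Gm.
  apply: (le_trans le); rewrite ler_wpM2l ?exprn_ge0//.
  apply: Ex_le => //; first exact: bmeasM.
  move=> w; rewrite ler_wpM2l//.
  by have [/andP[]] := exp_approx m0 (gG (t w)) Gm.
rewrite leNgt; apply/negP => lt.
pose e := L - 6 ^+ d * U.
have e0 : 0 < e by rewrite subr_gt0.
(* Large enough for [G <= m] and for the loss [G^2 L / m] to stay below the supposed gap [e]. *)
pose m := (Num.truncn (G + G ^+ 2 * L / e)).+1.
have q0 : 0 <= G ^+ 2 * L / e by rewrite divr_ge0 ?(ltW e0)// mulr_ge0 ?sqr_ge0.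
have mlt : G + G ^+ 2 * L / e < m%:R := truncnS_gt _.
have mp : 0 < m%:R :> R by rewrite ltr0n.
have := key m isT; have Gm : G <= m%:R by lra.
move=> /(_ Gm).
have : G ^+ 2 / m%:R * L < e.
  rewrite mulrAC ltr_pdivrMr// [ltRHS]mulrC -ltr_pdivrMr//; lra.
rewrite /e; lra.
Qed.

End PositiveCosineCombinations.

(** * The arithmetic hypothesis *)

Section LatticeBound.
Context {R : realType}.

Lemma cosBint2pi (x : R) (m : int) : cos (x - 2 * pi * m%:~R) = cos x.
Proof.
have nat_case (k : nat) y : cos (y + 2 * pi * k%:R) = cos y :> R.
  have -> : 2 * pi * k%:R = pi *+ 2 *+ k :> R.
    by rewrite -[pi *+ 2 *+ k]mulr_natr -[pi *+ 2]mulr_natr; ring.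
  exact: (periodicn (@cosD2pi R)).
case: m => k.
  by rewrite -(nat_case k (x - _)) subrK.
by rewrite NegzE mulrNz mulrN opprK; exact: nat_case.
Qed.

(** For [m] the nearest integer, [2 pi (r - m)] lies in [[-pi, pi]], where [cos_le_sqr] gives
    [pi^2 (r - m)^2 / 2]; then use [pi >= 2]. *)
Lemma one_sub_cos_ge (r : R) : exists m : int, 2 * (r - m%:~R) ^+ 2 <= 1 - cos (2 * pi * r).
Proof.
exists (Num.floor (r + 1 / 2)).
have := floor_itv (r + 1 / 2); set m := Num.floor _; rewrite intrD => /andP[m1 m2].
have pi2 := @pi_ge2 R.
rewrite -(cosBint2pi _ m) -mulrBr; set x := r - m%:~R.
have x2 : `|x| <= 1 / 2 by rewrite /x ler_norml; apply/andP; split; lra.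
have := @cos_le_sqr R (2 * pi * x); rewrite !normrM (@ger0_norm R 2)// (ger0_norm (pi_ge0 _)).
have -> : (2 * pi * `|x| <= pi).
  by have := ler_wpM2l (pi_ge0 R) x2; lra.
move=> /(_ isT); apply: le_trans.
rewrite !exprMn; have : 2 ^+ 2 * x ^+ 2 <= pi ^+ 2 * x ^+ 2.
  by rewrite ler_wpM2r ?sqr_ge0// lerXn2r ?nnegrE// pi_ge0.
rewrite !expr2; lra.
Qed.

Context (d n : nat) (a : 'I_n -> 'cV[R]_d).

(** The factor [1 / 2] is due to the square root: symmetrization controls the squared modulus of the
    characteristic function. *)
Definition cosdef (t : 'cV[R]_d) : R := \sum_k (1 - cos (dotp t (a k))) / 2.

Lemma cosdef_ge0 t : 0 <= cosdef t.
Proof. by apply: sumr_ge0 => k _; rewrite divr_ge0// subr_ge0 cos_le1. Qed.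

Lemma cosdef0 : cosdef 0 = 0.
Proof.
rewrite /cosdef big1// => k _; rewrite /dotp big1 ?cos0 ?subrr ?mul0r// => i _.
by rewrite mxE mul0r.
Qed.

Definition dotnorm (t : 'cV[R]_d) : R := Num.sqrt (\sum_k dotp t (a k) ^+ 2).

Definition gram : 'M[R]_d := \sum_k a k *m (a k)^T.

Lemma qform_gram t : qform gram t = dotnorm t ^+ 2.
Proof.
rewrite /dotnorm sqr_sqrtr ?sumr_ge0// => [|k _]; last exact: sqr_ge0.
rewrite /qform /gram mulmx_sumr mulmx_suml summxE; apply: eq_bigr => k _.
have e : (t^T *m a k) 0 0 = dotp t (a k).
  by rewrite mxE; apply: eq_bigr => i _; rewrite mxE.
have e' : ((a k)^T *m t) 0 0 = dotp t (a k).
  by rewrite mxE; apply: eq_bigr => i _; rewrite mxE mulrC.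
by rewrite mulmxA -mulmxA mxE big_ord1 e e' expr2.
Qed.

(** The quadratic form is a sum of squares of [dotp t (a k)]. If it vanishes, then [gram *m t = 0],
    and invertibility forces [t = 0]. *)
Lemma posdef_gram : 0 < \det gram -> posdef gram.
Proof.
move=> dg; split.
  by rewrite /gram linear_sum/=; apply: eq_bigr => k _; rewrite trmx_mul trmxK.
move=> t t0; rewrite qform_gram lt_neqAle sqr_ge0 andbT eq_sym sqrf_eq0.
apply: contra t0 => /eqP; rewrite /dotnorm => /eqP.
rewrite sqrtr_eq0 => s0.
have ek k : dotp t (a k) = 0.
  have sk (j : 'I_n) : 0 <= dotp t (a j) ^+ 2 by exact: sqr_ge0.
  have : \sum_k dotp t (a k) ^+ 2 == 0 by rewrite eq_le s0 sumr_ge0.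
  by rewrite psumr_eq0// => /allP/(_ k (mem_index_enum _))/=; rewrite sqrf_eq0 => /eqP.
have gt : gram *m t = 0.
  rewrite /gram mulmx_suml big1// => k _; rewrite -mulmxA.
  rewrite (_ : (a k)^T *m t = 0) ?mulmx0//; apply/matrixP => i j; rewrite !ord1 !mxE -[RHS](ek k).
  by apply: eq_bigr => l _; rewrite mxE mulrC.
have ug : gram \in unitmx by rewrite unitmxE unitfE gt_eqF.
by rewrite -(mulKmx ug t) gt mulmx0.
Qed.

Lemma dotnormZ z t : dotnorm (z *: t) = `|z| * dotnorm t.
Proof.
rewrite /dotnorm -sqrtr_sqr -sqrtrM ?sqr_ge0// mulr_sumr.
by congr Num.sqrt; apply: eq_bigr => k _; rewrite dotpZl exprMn.
Qed.

Variables (alpha gamma : R).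
Hypotheses (alpha0 : 0 < alpha) (gamma0 : 0 < gamma).
Hypothesis far : forall (m : 'I_n -> int) (t : 'cV[R]_d), \sum_i t i 0 ^+ 2 <= d%:R ->
  Num.min (gamma * dotnorm t) alpha <= Num.sqrt (\sum_k (dotp t (a k) - (m k)%:~R) ^+ 2).

Lemma cosdef_ge (z : R) (t : 'cV[R]_d) : (forall i, `|t i 0| <= 1) -> `|z| <= 1 ->
  Num.min (gamma * (`|z| / (2 * pi) * dotnorm t)) alpha ^+ 2 <= cosdef (z *: t).
Proof.
move=> t1 z1; have pi2 := @pi_ge2 R; have pi0 := @pi_gt0 R.
pose u := (z / (2 * pi)) *: t.
have zp : `|z / (2 * pi)| = `|z| / (2 * pi).
  by rewrite normrM normfV [`|2 * pi|]ger0_norm//; lra.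
have ud : \sum_i u i 0 ^+ 2 <= d%:R.
  rewrite -[d in d%:R]card_ord -sum1_card natr_sum ler_sum// => i _.
  rewrite mxE -real_normK ?num_real// exprn_ile1// normrM mulr_ile1// zp.
  by rewrite ler_pdivrMr; lra.
(* The hypothesis holds for every integer vector; the one used is coordinatewise nearest to the
   products [dotp u (a k)]. *)
pose m k := projT1 (cid (one_sub_cos_ge (dotp u (a k)))).
have mP k : 2 * (dotp u (a k) - (m k)%:~R) ^+ 2 <= 1 - cos (dotp (z *: t) (a k)).
  have := projT2 (cid (one_sub_cos_ge (dotp u (a k)))).
  congr (_ <= 1 - cos _); rewrite /u !dotpZl; field; lra.
have := far m ud; rewrite dotnormZ zp; set M := Num.min _ _ => h.
have M0 : 0 <= M.
  rewrite /M le_min (ltW alpha0) andbT mulr_ge0 ?(ltW gamma0)//.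
  by rewrite mulr_ge0 ?sqrtr_ge0// divr_ge0//; lra.
have s0 : 0 <= \sum_k (dotp u (a k) - (m k)%:~R) ^+ 2 by apply: sumr_ge0 => k _; exact: sqr_ge0.
have : M ^+ 2 <= \sum_k (dotp u (a k) - (m k)%:~R) ^+ 2.
  by rewrite -(sqr_sqrtr s0) lerXn2r ?nnegrE ?sqrtr_ge0.
move/le_trans; apply; apply: ler_sum => k _; rewrite ler_pdivlMr// mulrC; exact: mP.
Qed.

Context disp (O : measurableType disp) (mu : subprobability O R)
    (W : O -> R) (t : O -> 'cV[R]_d) (tv : tri2_vector mu W t).

Lemma measurable_cosdef (z : R) : measurable_fun setT (fun w => cosdef (z *: t w)).
Proof.
apply: bmeas_measurable; apply: bmeas_sum => k; apply: bmeasM; last exact: bmeas_cst.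
by apply: bmeasB; [exact: bmeas_cst|apply: bmeas_cos; exact: (measurable_dotpZ tv)].
Qed.

Lemma Ex_W1 : \int[mu]_w W w = 1.
Proof.
have := tri2v_cos tv (fun=> 0) 0; rewrite cos0 mulr1.
rewrite big1 => [<-|i _]; last by rewrite /kker eqxx.
by apply: eq_Rintegral => w _; rewrite big1 ?add0r ?cos0 ?mulr1// => i _; rewrite mulr0.
Qed.

(* [1 / min(z^2, 1)] for [z != 0], and [1] at [0]; [powR] rather than the
   inverse because its measurability is available. *)
Definition invtrunc (z : R) : R := Num.max 1 ((z ^+ 2) `^ (-1)).

Lemma invtruncE z : z != 0 -> invtrunc z = Num.max 1 (z ^+ 2)^-1.
Proof. by move=> z0; rewrite /invtrunc powR_inv1 ?sqr_ge0. Qed.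

(** Each coordinate contributes [gaussC] from the Gaussian integral and [2 pi] from rescaling the
    frequency. *)
Definition bound (M : R) : R := 
  (gaussC * (2 * pi)) ^+ d * ((1 / (gamma * Num.sqrt M)) ^+ d / Num.sqrt (\det gram))
  + expR (- (alpha ^+ 2 * M)).

Hypothesis detN : 0 < \det gram.

Lemma small_scale_bound (M z : R) : 0 < M -> z != 0 -> `|z| <= 1 ->
  \int[mu]_w (W w * expR (- (M * (z ^+ 2)^-1 * cosdef (z *: t w)))) <= bound M.
Proof.
move=> M0 z0 z1; have pi0 := @pi_gt0 R; have W0 := tri2v_ge0 tv; have bW := tri2v_bmeas tv.
have z2 : 0 < z ^+ 2 by rewrite exprn_even_gt0.
have z21 : z ^+ 2 <= 1 by rewrite -real_normK ?num_real// exprn_ile1.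
have pg := posdef_gram detN.
(* The exponent [M / z^2] times [(gamma |z| / (2 pi) * dotnorm (t w))^2] equals
   [(s * dotnorm (t w))^2], free of [z]. *)
pose s := gamma * Num.sqrt M / (2 * pi).
have sM : 0 < Num.sqrt M by rewrite sqrtr_gt0.
have s0 : 0 < s by rewrite /s divr_gt0 ?mulr_gt0.
pose kap := s ^+ 2.
have kap0 : 0 < kap by rewrite exprn_gt0.
have pk : posdef (kap *: gram).
  case: pg => sg pg; split; first by rewrite linearZ/= sg.
  move=> v v0; rewrite /qform -scalemxAr -scalemxAl mxE mulr_gt0//; exact: pg.
have bg : bmeas (fun w => W w * expR (- qform (kap *: gram) (t w))).
  apply: bmeasM => //; apply: bmeas_expN => [|w]; last exact: posdef_qform_ge0.
  exact: measurable_qform (tri2v_measurable tv).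
have be : bmeas (fun w => W w * expR (- (alpha ^+ 2 * M))).
  by apply: bmeasM => //; exact: bmeas_cst.
have bl : bmeas (fun w => W w * expR (- (M * (z ^+ 2)^-1 * cosdef (z *: t w)))).
  apply: bmeasM => //; apply: bmeas_expN => [|w].
    by apply: measurable_funM => //; exact: measurable_cosdef.
  by rewrite mulr_ge0 ?cosdef_ge0// mulr_ge0 ?invr_ge0 ?ltW.
apply: (@le_trans _ _ (\int[mu]_w (W w * expR (- qform (kap *: gram) (t w)) +
    W w * expR (- (alpha ^+ 2 * M))))).
  apply: Ex_le => // [|w]; first exact: bmeasD.
  (* The vector [t w] is known to lie in the cube only where the density is nonzero. *)
  have [->|Ww] := eqVneq (W w) 0; first by rewrite !mul0r addr0.
  rewrite -mulrDr ler_wpM2l//.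
  have := cosdef_ge (fun i => tri2v_supp tv i Ww) z1.
  set m := Num.min _ _; set c := cosdef _ => mc.
  have m' : M * (z ^+ 2)^-1 * m ^+ 2 <= M * (z ^+ 2)^-1 * c.
    by apply: ler_wpM2l => //; rewrite mulr_ge0 ?invr_ge0 ?(ltW M0)// ltW.
  apply: (@le_trans _ _ (expR (- (M * (z ^+ 2)^-1 * m ^+ 2)))).
    by rewrite ler_expR lerN2.
  rewrite /m minElt; case: ifP => _.
    apply: ler_wpDr; first exact: expR_ge0.
    rewrite ler_expR lerN2 /qform -scalemxAr -scalemxAl mxE -/(qform gram (t w)) qform_gram.
    rewrite !exprMn real_normK ?num_real// /kap /s !exprMn sqr_sqrtr ?(ltW M0)//.
    rewrite le_eqVlt; apply/orP; left; apply/eqP.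
    move: pi0; move: (@pi R) => p p0; field; by rewrite z0 gt_eqF.
  apply: ler_wpDl; first exact: expR_ge0.
  rewrite ler_expR lerN2 (_ : M * _ * _ = alpha ^+ 2 * M * (z ^+ 2)^-1); last by ring.
  rewrite ler_peMr ?invf_ge1//.
  by rewrite mulr_ge0 ?sqr_ge0 ?(ltW M0).
rewrite ExD// ExZr// Ex_W1 mul1r /bound lerD2r.
apply: le_trans (tri2v_gauss tv pk) _.
rewrite detZ sqrtrM; last by rewrite exprn_ge0// ltW.
have -> : Num.sqrt (kap ^+ d) = s ^+ d.
  by rewrite /kap -exprM mulnC exprM sqrtr_sqr ger0_norm// exprn_ge0// ltW.
rewrite le_eqVlt; apply/orP; left; apply/eqP.
rewrite /s !mulrA -exprMn invfM mulrA -exprVn -exprMn; congr (_ ^+ d / _).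
move: pi0 sM; move: (@pi R) (Num.sqrt M) => p q p0 q0; field.
by rewrite !gt_eqF.
Qed.

Lemma scale_bound (M z : R) : 0 < M -> z != 0 ->
  \int[mu]_w (W w * expR (- (M * invtrunc z * cosdef (z *: t w)))) <= 6 ^+ d * bound M.
Proof.
move=> M0 z0; rewrite invtruncE//; have pi0 := @pi_gt0 R.
have z2 : 0 < z ^+ 2 by rewrite exprn_even_gt0.
have B0 : 0 <= bound M.
  apply: le_trans (small_scale_bound M0 (oner_neq0 _) _); last by rewrite normr1.
  by apply: Ex_ge0 => w; rewrite mulr_ge0 ?expR_ge0// (tri2v_ge0 tv).
case: (leP `|z| 1) => z1.
  rewrite max_r; last by rewrite invf_ge1// -real_normK ?num_real// exprn_ile1.
  apply: le_trans (small_scale_bound M0 z0 z1) _.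
  by rewrite ler_peMl// exprn_ege1//; lra.
rewrite max_l; last by rewrite invf_le1// -real_normK ?num_real// exprn_ege1// ltW.
(* Up to a constant factor, [exp (- M h)] is the exponential of a nonnegative combination of
   cosines, as [exp_cos_scale] requires. *)
have expE v : expR (- (M * 1 * cosdef v)) =
    expR (- (M * n%:R / 2)) * expR (M / 2 * \sum_k cos (dotp v (a k))).
  rewrite -expRD; congr expR; rewrite /cosdef -mulr_suml sumrB sumr_const card_ord.
  by rewrite -mulr_natr; field.
have bE v : bmeas (fun w => W w * expR (M / 2 * \sum_k cos (dotp (v *: t w) (a k)))).
  apply: bmeasM; first exact: (tri2v_bmeas tv).
  apply: bmeas_exp; apply: bmeasM; first exact: bmeas_cst.
  by apply: bmeas_sum => k; apply: bmeas_cos; exact: (measurable_dotpZ tv).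
have bE1 : bmeas (fun w => W w * expR (M / 2 * \sum_k cos (dotp (t w) (a k)))).
  by have := bE 1; under eq_fun do rewrite scale1r.
under eq_Rintegral do rewrite expE mulrCA.
rewrite ExZ; last exact: bE.
have := small_scale_bound M0 (oner_neq0 _); rewrite normr1 expr1n invr1 => /(_ (lexx _)).
under eq_Rintegral do rewrite expE scale1r mulrCA.
rewrite ExZ// => h.
apply: le_trans (ler_wpM2l (expR_ge0 _) (exp_cos_scale tv a _ (ltW z1))) _.
  by rewrite divr_ge0// ltW.
by rewrite mulrCA ler_wpM2l// exprn_ge0.
Qed.

End LatticeBound.

(** * Jensen and Esseen inequalities *)

Section Jensen.
Context {R : realType} d (T : measurableType d) (L : subprobability T R).

(* Jensen for [exp], with respect to the probability [q / m * L], obtained by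
   integrating the tangent line inequality at the mean. *)
Lemma jensen_weighted (q r h : T -> R) (m : R) :
  bmeas q -> bmeas h -> measurable_fun setT r ->
  (forall z, 0 <= q z) -> (forall z, 0 <= r z) -> (forall z, 0 <= h z) ->
  (forall z, q z * r z * h z = h z) ->
  0 < m -> \int[L]_z q z = m ->
  m * expR (- \int[L]_z h z) <= \int[L]_z (q z * expR (- (m * r z * h z))).
Proof.
move=> bq bh mr q0 r0 h0 qrh m0 qm.
set S := \int[L]_z h z.
have be : bmeas (fun z => q z * expR (- (m * r z * h z))).
  apply: bmeasM => //; apply: bmeas_expN => [|z]; last first.
    by rewrite mulr_ge0// mulr_ge0// ltW.
  apply: measurable_funM; last exact: bmeas_measurable bh.
  exact: measurable_funM.
have bt : bmeas (fun z => (1 + S) * q z - m * h z).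
  by apply: bmeasB; apply: bmeasM => //; exact: bmeas_cst.
have -> : m * expR (- S) = \int[L]_z (expR (- S) * ((1 + S) * q z - m * h z)).
  rewrite ExZ// ExB; last 2 first.
  - by apply: bmeasM => //; exact: bmeas_cst.
  - by apply: bmeasM => //; exact: bmeas_cst.
  by rewrite !ExZ// qm -/S; ring.
apply: Ex_le => // [|z]; first by apply: bmeasM => //; exact: bmeas_cst.
(* [qrh] makes [r] the inverse of [q] wherever [h] is nonzero; this brings out a common factor [q z]
   even where [q] vanishes. *)
rewrite -{1}(qrh z).
have -> : (1 + S) * q z - m * (q z * r z * h z) = q z * (1 + (S - m * r z * h z)) by ring.
rewrite mulrCA ler_wpM2l//.
have -> : expR (- (m * r z * h z)) = expR (- S) * expR (S - m * r z * h z).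
  by rewrite -expRD; congr expR; ring.
by rewrite ler_wpM2l ?expR_ge0// expR_ge1Dx.
Qed.

End Jensen.

Section BallKernel.
Context {R : realType}.

Definition kernC : R := 16 / 3 * expR 1.

(** In [kernC], [16 / 3] undoes the constant of the Gaussian minorant, and [exp 1] per coordinate
    compensates [exp (- sum_i y_i^2) >= exp (- d)]. *)
Lemma ball_le_prod_kker d (y : 'I_d -> R) : \sum_i y i ^+ 2 <= d%:R ->
  1 <= kernC ^+ d * \prod_i kker (y i).
Proof.
move=> yd; apply: (@le_trans _ _ (kernC ^+ d * \prod_(i < d) (3 / 16 * expR (- y i ^+ 2)))).
  rewrite big_split/= prodr_const card_ord -expR_sum sumrN /kernC exprMn.
  rewrite -expRM_natl mulr1 mulrACA -exprMn -expRD.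
  have -> : 16 / 3 * (3 / 16) = 1 :> R by field.
  rewrite expr1n mul1r; apply: le_trans (expR_ge1Dx _).
  by rewrite lerDl subr_ge0.
rewrite ler_wpM2l ?exprn_ge0 ?mulr_ge0 ?expR_ge0 ?divr_ge0//.
apply: ler_prod => i _; rewrite kker_ge_gauss andbT.
by rewrite mulr_ge0 ?expR_ge0 ?divr_ge0.
Qed.

End BallKernel.

Lemma measurable_shifted_ball (R : realType) d dT (T : measurableType dT)
    (Y : T -> 'cV[R]_d) (x : 'cV[R]_d) (r : R) :
  (forall i, measurable_fun setT (fun w => Y w i 0)) ->
  measurable [set w | \sum_i (Y w - x) i 0 ^+ 2 <= r].
Proof.
move=> mY.
have mS : measurable_fun setT (fun w => \sum_i (Y w - x) i 0 ^+ 2).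
  apply: measurable_fun_bigsum => i; apply: measurable_funX.
  under eq_fun do rewrite mxE [(- x) i 0]mxE.
  exact: measurable_funB.
have := measurable_preimage mS (measurable_itv `]-oo, r]).
by congr (measurable _); apply/seteqP; split => w; rewrite /= in_itv.
Qed.

Section Esseen.
Context {R : realType} d disp (O : measurableType disp) (mu : subprobability O R)
    (W : O -> R) (t : O -> 'cV[R]_d) (tv : tri2_vector mu W t).
Context dT (T : measurableType dT) (P : probability T R).

(** Bounding the cosine for every phase [c] replaces a bound on the modulus of the characteristic
    function. The phase used is [- dotp (t o) x], which accounts for the centre of the ball. *)
Lemma esseen (Y : T -> 'cV[R]_d) (Phi : O -> R) :
  (forall i, measurable_fun setT (fun w => Y w i 0)) ->
  bmeas Phi ->
  (forall o c, \int[P]_w cos (dotp (t o) (Y w) + c) <= Phi o) ->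
  forall x : 'cV[R]_d,
  fine (P [set w | \sum_i (Y w - x) i 0 ^+ 2 <= d%:R]) <=
    kernC ^+ d * \int[mu]_o (W o * Phi o).
Proof.
move=> mY bPhi YPhi x; have bW := tri2v_bmeas tv; have W0 := tri2v_ge0 tv.
set A := [set w | _].
have mA : measurable A by exact: measurable_shifted_ball.
have k0 : 0 <= kernC ^+ d :> R by rewrite exprn_ge0 ?mulr_ge0 ?expR_ge0 ?divr_ge0.
pose f (z : T * O) := W z.2 * cos (dotp (t z.2) (Y z.1) + - dotp (t z.2) x).
have md (v : O -> 'cV[R]_d) (V : T * O -> 'cV[R]_d) :
    (forall i, measurable_fun setT (fun o => v o i 0)) ->
    (forall i, measurable_fun setT (fun z => V z i 0)) ->
    measurable_fun setT (fun z : T * O => dotp (v z.2) (V z)).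
  move=> mv mV; apply: measurable_fun_bigsum => i; apply: measurable_funM => //.
  exact: (measurableT_comp (mv i) measurable_snd).
have bf : bmeas f.
  apply: bmeasM; first by apply: (bmeas_comp bW); exact: measurable_snd.
  apply: bmeas_cos; apply: measurable_funD.
    apply: md => i; first exact: (tri2v_measurable tv).
    exact: (measurableT_comp (mY i) measurable_fst).
  apply: measurable_funN; apply: md => i; first exact: (tri2v_measurable tv).
  exact: measurable_cst.
have fE w : \int[mu]_o f (w, o) = \prod_i kker ((Y w - x) i 0).
  have := tri2v_cos tv (fun i => (Y w - x) i 0) 0; rewrite cos0 mulr1 => <-.
  apply: eq_Rintegral => o _; rewrite /f/=; congr (_ * cos _).
  by rewrite addr0 -dotpNr -dotpDr.
have bk := bmeas_Ex2 P mu bf.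
rewrite -(Ex_indic P mA).
apply: (@le_trans _ _ (\int[P]_w (kernC ^+ d * \int[mu]_o f (w, o)))).
  apply: Ex_le; [exact: bmeas_indic | by apply: bmeasM => //; exact: bmeas_cst|].
  move=> w; rewrite fE indicE.
  case: (boolP (w \in A)) => [|_]; last by rewrite mulr_ge0// prodr_ge0// => i _; exact: kker_ge0.
  by rewrite inE => wA; exact: ball_le_prod_kker.
rewrite ExZ// (Ex_swap P mu bf) ler_wpM2l//.
apply: Ex_le; [exact: (bmeas_Ex1 P mu bf)|exact: bmeasM|].
move=> o; rewrite /f/= ExZ; first by rewrite ler_wpM2l.
apply: bmeas_cos; apply: measurable_funD => //; apply: measurable_fun_bigsum => i.
exact: measurable_funM.
Qed.

End Esseen.

(** * Decay of the characteristic function through symmetrization *)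

Section CharacteristicBound.
Context {R : realType} dT (T : measurableType dT) (P : probability T R) (n : nat)
  (X : T -> R) (Xs : 'I_n -> T -> R).
Hypotheses (mX : measurable_fun setT X) (mXs : forall k, measurable_fun setT (Xs k)).
Hypothesis ind : forall B : 'I_n -> set R, (forall i, measurable (B i)) ->
  P [set w | forall i, B i (Xs i w)] = (\prod_i P (Xs i @^-1` B i))%E.
Hypothesis law : forall k (B : set R), measurable B -> P (Xs k @^-1` B) = P (X @^-1` B).

Definition symm (z : T * T) : R := X z.1 - X z.2.
Let L : subprobability (T * T)%type R := product_subprobability (P : subprobability T R, P : subprobability T R).

Lemma measurable_symm : measurable_fun setT symm.
Proof.
apply: measurable_funB.
  exact: (measurableT_comp mX measurable_fst).
exact: (measurableT_comp mX measurable_snd).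
Qed.

(** The left side is [E cos (s Z)] for the symmetrized [Z]; apply [1 - u <= exp (- u)] with
    [u = E (1 - cos (s Z))]. *)
Lemma char_sqr_le (s : R) :
  (\int[P]_w cos (s * X w)) ^+ 2 + (\int[P]_w sin (s * X w)) ^+ 2 <=
  expR (- \int[L]_z (1 - cos (symm z * s))).
Proof.
have bc : bmeas (fun z : T * T => cos (symm z * s)).
  by apply: bmeas_cos; apply: measurable_funM => //; exact: measurable_symm.
have L1 : \int[L]_z 1 = 1.
  rewrite -(Ex_prod2 P P (f := fun=> 1)); last exact: bmeas_cst.
  by rewrite !Ex_prob_cst.
rewrite ExB//; last exact: bmeas_cst.
rewrite L1 -(Ex_prod2 P P bc) Ex_cos_sin_sqr//.
have -> : \int[P]_w \int[P]_w' cos (s * (X w - X w')) =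
    \int[P]_w \int[P]_w' cos (symm (w, w') * s).
  by apply: eq_Rintegral => w _; apply: eq_Rintegral => w' _; rewrite mulrC.
by set I := \int[P]_w _; have := expR_ge1Dx (- (1 - I)); apply: le_trans; lra.
Qed.

Lemma char_sum_le d (a : 'I_n -> 'cV[R]_d) (t : 'cV[R]_d) (c : R) :
  \int[P]_w cos (dotp t (\sum_k (Xs k w *: a k)) + c) <=
  expR (- \int[L]_z cosdef a (symm z *: t)).
Proof.
pose s k := dotp t (a k).
have mth k : measurable_fun setT (fun w => s k * Xs k w) by exact: measurable_funM.
have e1 : \int[P]_w cos (dotp t (\sum_k (Xs k w *: a k)) + c) =
    \int[P]_w cos (\sum_k s k * Xs k w + c).
  apply: eq_Rintegral => w _; congr (cos (_ + c)).
  rewrite /dotp; under eq_bigr do rewrite summxE mulr_sumr.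
  rewrite exchange_big/=; apply: eq_bigr => k _; rewrite /s /dotp mulr_suml.
  by apply: eq_bigr => i _; rewrite mxE; ring.
have bk k : bmeas (fun z => (1 - cos (symm z * s k)) / 2).
  apply: bmeasM; last exact: bmeas_cst; apply: bmeasB; first exact: bmeas_cst.
  by apply: bmeas_cos; apply: measurable_funM => //; exact: measurable_symm.
have e2 : \int[L]_z cosdef a (symm z *: t) = \sum_k \int[L]_z ((1 - cos (symm z * s k)) / 2).
  rewrite -Ex_sum//; apply: eq_Rintegral => z _; rewrite /cosdef.
  by apply: eq_bigr => k _; rewrite dotpZl.
rewrite e1; set E := expR _; have E0 : 0 <= E by exact: expR_ge0.
have : (\int[P]_w cos (\sum_k s k * Xs k w + c)) ^+ 2 <= E ^+ 2.
  apply: le_trans (Ex_cos_sum_le c mth _) _.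
    move=> B mB.
    have mB' k : measurable ((fun x : R => s k * x) @^-1` B k).
      by apply: measurable_preimage => //; exact: measurable_funM.
    exact: ind mB'.
  have -> : E ^+ 2 = \prod_k expR (- \int[L]_z (1 - cos (symm z * s k))).
    rewrite -expR_sum /E -expRM_natl e2 mulrN mulr_sumr sumrN; congr (expR (- _)).
    apply: eq_bigr => k _; rewrite ExZr; first by field.
    apply: bmeasB; first exact: bmeas_cst.
    by apply: bmeas_cos; apply: measurable_funM => //; exact: measurable_symm.
  apply: ler_prod => k _; rewrite addr_ge0 ?sqr_ge0//=.
  apply: le_trans (char_sqr_le (s k)).
  (* Each summand is replaced by the common variable [X], from which the symmetrization is built. *)
  have mtr (f : R -> R) : continuous f -> (forall x, `|f x| <= 1) ->
      \int[P]_w f (s k * Xs k w) = \int[P]_w f (s k * X w).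
    move=> cf f1.
    have mf : measurable_fun setT (fun x => f (s k * x)).
      apply: measurableT_comp; first exact: continuous_measurable_fun.
      exact: measurable_funM.
    apply: Ex_same_law => //; [exact: (measurableT_comp mf (mXs k)) | exact: (measurableT_comp mf mX)|].
    move=> B mB; exact: (law k (measurable_preimage mf mB)).
  by rewrite (mtr cos) ?(mtr sin)//; first [exact: continuous_cos | exact: continuous_sin | exact: cos_max | exact: sin_max].
move=> h; apply: le_trans (ler_norm _) _.
by rewrite -(ger0_norm E0) -ler_sqr ?nnegrE// !real_normK ?num_real.
Qed.

End CharacteristicBound.

(** * Combining the estimates *)

Section Assembly.
Context dT (T : measurableType dT) (P : probability T RR).

(** The event attached to [None], that is to [X], is taken to be the whole line, of probability
    [1]. *)
Lemma independent_restrict (n : nat) (X : T -> RR) (Xs : 'I_n -> T -> RR) :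
  mutually_independent P (fun i : option 'I_n => if i is Some k then Xs k else X) ->
  forall B : 'I_n -> set RR, (forall i, measurable (B i)) ->
  P [set w | forall i, B i (Xs i w)] = (\prod_i P (Xs i @^-1` B i))%E.
Proof.
move=> ind B mB.
have := ind (fun i : option 'I_n => if i is Some k then B k else setT).
rewrite (bigD1 None)//= preimage_setT probability_setT mul1e.
rewrite (reindex_omap Some id) => [/=|[k|]]//.
under eq_bigl do rewrite eqxx.
move=> <-; last by case.
congr (P _); apply/seteqP; split => [w wB [k|]|w wB k]//.
exact: (wB (Some k)).
Qed.

Lemma Mfun_Ex (X : T -> RR) : measurable_fun setT X ->
  let q z : RR := Num.min (symm X z ^+ 2) 1 in
  bmeas q /\ Mfun P X 1 = \int[product_subprobability (P : subprobability T RR, P : subprobability T RR)]_z q z.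
Proof.
move=> mX q.
have bq : bmeas q.
  split.
    apply: measurable_minr => //; apply: measurable_funX; exact: measurable_symm.
  exists 1 => z; rewrite ger0_norm; first by rewrite ge_min lexx orbT.
  by rewrite le_min sqr_ge0 ler01.
split => //; rewrite -(Ex_prod2 P P bq) {1}/Rintegral /Mfun; congr fine.
apply: eq_integral => w _; rewrite EFin_Ex; last exact: (bmeas_snd w bq).
by apply: eq_integral => w' _; rewrite expr1n divr1.
Qed.

Lemma measurable_Ssum d n (a : 'I_n -> 'cV[RR]_d) (Xs : 'I_n -> T -> RR) :
  (forall k, measurable_fun setT (Xs k)) ->
  forall i, measurable_fun setT (fun w => Ssum Xs a w i 0).
Proof.
move=> mXs i; rewrite /Ssum; under eq_fun do rewrite summxE.
apply: measurable_fun_bigsum => k; under eq_fun do rewrite mxE.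
exact: measurable_funM.
Qed.

Lemma ball_bound d n (a : 'I_n -> 'cV[RR]_d) (X : T -> RR) (Xs : 'I_n -> T -> RR) (alpha gamma : RR) :
  measurable_fun setT X -> (forall k, measurable_fun setT (Xs k)) ->
  (forall B : 'I_n -> set RR, (forall i, measurable (B i)) ->
    P [set w | forall i, B i (Xs i w)] = (\prod_i P (Xs i @^-1` B i))%E) ->
  (forall k (B : set RR), measurable B -> P (Xs k @^-1` B) = P (X @^-1` B)) ->
  0 < alpha -> 0 < gamma ->
  (forall (m : 'I_n -> int) (t : 'cV[RR]_d), \sum_i t i 0 ^+ 2 <= d%:R ->
    Num.min (gamma * dotnorm a t) alpha <= Num.sqrt (\sum_k (dotp t (a k) - (m k)%:~R) ^+ 2)) ->
  0 < \det (gram a) -> 0 < Mfun P X 1 ->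
  forall x : 'cV[RR]_d,
  fine (P [set w | \sum_i (Ssum Xs a w - x) i 0 ^+ 2 <= d%:R]) <=
    kernC ^+ d * (6 ^+ d * bound a alpha gamma (Mfun P X 1)).
Proof.
move=> mX mXs ind law a0 g0 far dN M0 x.
have [disp [Om [mu [W [t tv]]]]] := @tri2_vector_exists RR d.
have [bq Mq] := Mfun_Ex mX.
set M := Mfun P X 1 in M0 Mq *; set L := product_subprobability _ in Mq.
pose q z : RR := Num.min (symm X z ^+ 2) 1.
have bW := tri2v_bmeas tv; have W0 := tri2v_ge0 tv.
have mZ := measurable_symm mX.
have q0 z : 0 <= q z by rewrite le_min sqr_ge0 ler01.
have r0 z : 0 <= invtrunc z :> RR by rewrite le_max ler01.
have mr : measurable_fun setT (fun z => invtrunc (symm X z)).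
  apply: measurable_maxr => //.
  apply: (measurableT_comp (measurable_powR (-1))); exact: measurable_funX.
have mdot u : measurable_fun setT (fun p : (T * T) * Om => dotp (symm X p.1 *: t p.2) u).
  under eq_fun do rewrite dotpZl.
  apply: measurable_funM; first exact: (measurableT_comp mZ measurable_fst).
  exact: (measurableT_comp (measurable_dotp tv u) measurable_snd).
have bc : bmeas (fun p : (T * T) * Om => cosdef a (symm X p.1 *: t p.2)).
  apply: bmeas_sum => k; apply: bmeasM; last exact: bmeas_cst.
  by apply: bmeasB; [exact: bmeas_cst|exact: bmeas_cos].
pose Psi (p : (T * T) * Om) := W p.2 * (q p.1 *
   expR (- (M * invtrunc (symm X p.1) * cosdef a (symm X p.1 *: t p.2)))).
have be : bmeas (fun p : (T * T) * Om =>
    expR (- (M * invtrunc (symm X p.1) * cosdef a (symm X p.1 *: t p.2)))).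
  apply: bmeas_expN => [|p]; last by rewrite !mulr_ge0 ?cosdef_ge0// ltW.
  apply: measurable_funM; last exact: bmeas_measurable bc.
  by apply: measurable_funM => //; exact: (measurableT_comp mr measurable_fst).
have bPsi : bmeas Psi.
  apply: bmeasM; first by apply: (bmeas_comp bW); exact: measurable_snd.
  by apply: bmeasM => //; apply: (bmeas_comp bq); exact: measurable_fst.
pose Phi o := expR (- \int[L]_z cosdef a (symm X z *: t o)).
have bPhi : bmeas Phi.
  apply: bmeas_exp; apply: bmeasN; exact: (bmeas_Ex1 L mu bc).
have mS := measurable_Ssum a mXs.
apply: le_trans (esseen tv mS bPhi _ x) _.
  by move=> o c; exact: (char_sum_le mX mXs ind law a (t o) c).
rewrite ler_wpM2l; first by [].
  by rewrite exprn_ge0// mulr_ge0 ?expR_ge0// divr_ge0.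
(* The inequality is multiplied by [M], the total mass of the weight [q], to match the unnormalized
   form of Jensen. *)
rewrite -(ler_pM2l M0) -ExZ; last exact: bmeasM.
apply: (@le_trans _ _ (\int[mu]_o \int[L]_z Psi (z, o))).
  apply: Ex_le; [by apply: bmeasM; [exact: bmeas_cst|exact: bmeasM]|exact: (bmeas_Ex1 L mu bPsi)|].
  move=> o; rewrite /Psi/= ExZ; last first.
    by apply: bmeasM => //; exact: (bmeas_fst o be).
  rewrite mulrCA ler_wpM2l//.
  apply: (jensen_weighted (L := L) (q := q) (r := fun z => invtrunc (symm X z))) => //.
  - exact: (bmeas_fst o bc).
  - by move=> z; exact: cosdef_ge0.
  - move=> z; have [->|z0] := eqVneq (symm X z) 0.
      by rewrite scale0r cosdef0 mulr0.
    suff -> : q z * invtrunc (symm X z) = 1 by rewrite mul1r.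
    rewrite invtruncE// /q; move: (symm X z) z0 => y y0.
    have y2 : 0 < y ^+ 2 by rewrite exprn_even_gt0.
    case: (leP (y ^+ 2) 1) => y1.
      by rewrite max_r ?divff ?gt_eqF// invf_ge1.
    by rewrite max_l ?mul1r// invf_le1// ltW.
(* With [z] outermost, the inner integral has a bound not depending on [z], and integrating [q]
   restores the factor [M]. *)
rewrite -(Ex_swap L mu bPsi).
apply: (@le_trans _ _ (\int[L]_z (q z * (6 ^+ d * bound a alpha gamma M)))).
  apply: Ex_le; [exact: (bmeas_Ex2 L mu bPsi)|by apply: bmeasM => //; exact: bmeas_cst|].
  move=> z; rewrite /Psi/=; under eq_Rintegral do rewrite mulrCA.
  rewrite ExZ; last by apply: bmeasM => //; exact: (bmeas_snd z be).
  (* [scale_bound] excludes [z = 0], but there the weight vanishes. *)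
  have [z0|z0] := eqVneq (symm X z) 0.
    by rewrite /q z0 expr0n/= min_l// !mul0r.
  by rewrite ler_wpM2l//; exact: (scale_bound a0 g0 far tv dN M0 z0).
by rewrite ExZr// -Mq.
Qed.

End Assembly.

Theorem theorem2 :
  exists (C c : RR), 1 <= C /\ 0 < c /\
  forall (d n : nat), (0 < d)%N -> (0 < n)%N ->
  forall (dT : measure_display) (T : measurableType dT) (P : probability T RR)
    (X : T -> RR) (Xs : 'I_n -> T -> RR),
    measurable_fun [set: T] X ->
    (forall k, measurable_fun [set: T] (Xs k)) ->
    mutually_independent P (fun i : option 'I_n =>
                              if i is Some k then Xs k else X) ->
    (forall k (B : set RR), measurable B -> P (Xs k @^-1` B) = P (X @^-1` B)) ->
  forall (a : 'I_n -> 'cV[RR]_d) (alpha gamma : RR),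
    0 < alpha -> 0 < gamma < 1 ->
    (forall (m : 'I_n -> int) (t : 'cV[RR]_d),
        vnorm t <= Num.sqrt (d%:R) ->
        Num.sqrt (\sum_k (inner t (a k) - (m k)%:~R) ^+ 2)
          >= Num.min (gamma * tdot_norm a t) alpha) ->
    0 < \det (Nmat a) -> 0 < Mfun P X 1 ->
    (concentration P (Ssum Xs a) (Num.sqrt (d%:R))
      <= (C ^+ d * ((1 / (gamma * Num.sqrt (Mfun P X 1))) ^+ d
                      / Num.sqrt (\det (Nmat a))
                    + expR (- (c * alpha ^+ 2 * Mfun P X 1))))%:E)%E.
Proof.
pose G : RR := gaussC * (2 * pi).
have G0 : 0 <= G.
  by rewrite /G mulr_ge0// ?mulr_ge0 ?sqrtr_ge0 ?pi_ge0// divr_ge0.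
pose K : RR := kernC * 6.
have K1 : 1 <= K.
  by have := @expR_ge1Dx RR 1; rewrite /K /kernC; lra.
(* [K] collects the ball kernel and the dilation factor [6]. The Gaussian term carries [G^d] and the
   other term [1]; [(1 + G)^d] dominates both. *)
exists (K * (1 + G)), 1; split; [|split => //].
  by rewrite mulr_ege1//; lra.
move=> d n _ _ dT T P X Xs mX mXs ind law a alpha gamma a0 /andP[g0 _] far dN M0.
apply: ge_ereal_sup => _ [x _ <-].
have farE (m : 'I_n -> int) (t : 'cV[RR]_d) : \sum_i t i 0 ^+ 2 <= d%:R ->
    Num.min (gamma * dotnorm a t) alpha <= Num.sqrt (\sum_k (dotp t (a k) - (m k)%:~R) ^+ 2).
  by move=> td; apply: far; exact: ler_wsqrtr.
have := ball_bound mX mXs (independent_restrict ind) law a0 g0 farE dN M0 x.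
set A := [set w | _] => PA.
have -> : [set w | vnorm (Ssum Xs a w - x) <= Num.sqrt d%:R] = A.
  by apply/seteqP; split => w; rewrite /A/= /vnorm ler_sqrt.
have mA : measurable A by apply: measurable_shifted_ball; exact: measurable_Ssum.
rewrite -[P A]fineK ?fin_num_measure//.
rewrite lee_fin (le_trans PA)// mulrA -exprMn -/K [in leRHS]exprMn -[leRHS]mulrA.
apply: ler_wpM2l; first by rewrite exprn_ge0//; lra.
have G1 : 1 <= (1 + G) ^+ d by rewrite exprn_ege1//; lra.
rewrite /bound -/G mulrDr; apply: lerD.
  apply: ler_wpM2r.
    by rewrite divr_ge0 ?sqrtr_ge0// exprn_ge0// divr_ge0// mulr_ge0 ?sqrtr_ge0// ltW.
  by rewrite lerXn2r ?nnegrE//; lra.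
by rewrite mul1r ler_peMl ?expR_ge0.
Qed.
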